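(* There exists an effective graph model $\mathcal{G}$ whose order theory and equational theory are the minimum order graph theory and the minimum equational graph theory, i.e. for every graph model $\mathcal{G}'$ one has $\mathrm{Th}_{\sqsubseteq}(\mathcal{G})\subseteq \mathrm{Th}_{\sqsubseteq}(\mathcal{G}')$ and $\mathrm{Th}(\mathcal{G})\subseteq \mathrm{Th}(\mathcal{G}')$.
   Context: **Graph models.** For a set $G$, $G^*$ is the set of finite subsets of $G$ and $\mathcal{P}(G)$ its powerset. A *total pair* is a pair $(G,i)$ with $G$ an infinite set and $i:G^*\times G\to G$ an injective total function. The *graph model* $\mathcal{G}$ with web $(G,i)$ is the reflexive cpo $((\mathcal{P}(G),\subseteq),\lambda,\mathrm{Ap})$ where, for Scott continuous $f:\mathcal{P}(G)\to\mathcal{P}(G)$ and $X,Y\subseteq G$: $\lambda(f)=\{i(a,\alpha): a\in G^*,\alpha\in f(a)\}$ and $\mathrm{Ap}(X)(Y)=\{\alpha\in G:\exists a\subseteq Y\text{ finite},\ i(a,\alpha)\in X\}$. **$\lambda$-models and theories.** A $\lambda$-model (in the continuous semantics) is $\mathcal{M}=(D,\mathrm{Ap},\lambda)$ with $D$ a cpo and Scott continuous $\mathrm{Ap}:D\to[D\to D]$, $\lambda:[D\to D]\to D$ with $\mathrm{Ap}\circ\lambda=\mathrm{id}$ ($[D\to D]$ = Scott continuous functions ordered pointwise). Write $uv=\mathrm{Ap}(u)(v)$. For environments $\rho:\mathrm{Var}\to D$ the interpretation of untyped $\lambda$-terms is $|x|_\rho=\rho(x)$, $|MN|_\rho=\mathrm{Ap}(|M|_\rho)(|N|_\rho)$,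 $|\lambda x.M|_\rho=\lambda(e\mapsto|M|_{\rho[x:=e]})$. $\mathrm{Th}(\mathcal{M})=\{(M,N):|M|_\rho=|N|_\rho\ \forall\rho\}$ and $\mathrm{Th}_{\sqsubseteq}(\mathcal{M})=\{(M,N):|M|_\rho\sqsubseteq|N|_\rho\ \forall\rho\}$. A graph theory is the theory of a graph model. **Effectivity.** A Scott domain is a bounded complete $\omega$-algebraic cpo; $\mathcal{K}(D)$ is the set of compact elements. An *effective domain* is a Scott domain $D$ with a total surjection $d:\mathbb{N}\to\mathcal{K}(D)$ such that ''$d_m$ and $d_n$ have an upper bound'' is decidable in $(m,n)$ and ''$d_n=d_m\sqcup d_k$'' is decidable in $(m,n,k)$. An element $v$ is *r.e.* (resp. *decidable* ) if $\widehat v=\{n:d_n\sqsubseteq v\}$ is r.e. (resp. decidable); $D^{\mathrm{r.e.}}$, $D^{\mathrm{dec}}$ denote the sets of such elements. $[D\to D']$ is an effective domain via the canonical numeration of its compact elements: $n$ codes a finite set of index pairs $\{(m_i,n_i)\}_{i\in I}$; if for every $J\subseteq I$ with $\{d_{m_j}\}_{j\in J}$ bounded also $\{d'_{n_j}\}_{j\in J}$ is bounded, $n$ names $\bigsqcup_{i\in I}\varepsilon_{d_{m_i},d'_{n_i}}$ with $\varepsilon_{a,b}(x)=b$ if $a\sqsubseteq x$, $\bot$ otherwise; else $n$ names $\bot$. A $\lambda$-model is *weakly effective* if $D$ is (equipped with the structure of) an effective domain and $\mathrm{Ap}$, $\lambda$ are r.e. elements of $[D\to[D\to D]]$, $[[D\to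 D]\to D]$. It is *effective* if moreover: (1) $d\in\mathcal{K}(D)$, $e_1,\dots,e_k\in D^{\mathrm{dec}}$ imply $de_1\cdots e_k\in D^{\mathrm{dec}}$; (2) if $f\in[D\to D]^{\mathrm{r.e.}}$ and $f(d)\in D^{\mathrm{dec}}$ for all $d\in\mathcal{K}(D)$, then $\lambda(f)\in D^{\mathrm{dec}}$.
   Formalization: In condition (2) of ''effective'', ''f(d) decidable for all compact d'' is read uniformly: {(m,n) : d_n ⊑ f(d_m)} is decidable. With the pointwise reading no graph model is effective, so the literal statement is false. *)

(* Defs.v *)
From HB Require Import structures.
From mathcomp Require Import all_boot all_order finmap.
From mathcomp Require Import zify.
From mathcomp Require Import boolp classical_sets functions cardinality.

Set Implicit Arguments.
Unset Strict Implicit.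
Unset Printing Implicit Defensive.

Import Order.TTheory.
Local Open Scope classical_set_scope.
Local Open Scope order_scope.

Inductive recfun : nat -> Type :=
| rec_zero n : recfun n
| rec_succ : recfun 1
| rec_proj n (i : 'I_n) : recfun n
| rec_comp m n (f : recfun m) (g : 'I_m -> recfun n) : recfun n
| rec_prim n (f : recfun n) (g : recfun n.+2) : recfun n.+1
| rec_mu n (f : recfun n.+1) : recfun n.

(* Graph of the partial recursive function denoted by f.
   The recursion variable of rec_prim and the searched variable of rec_mu are
   the first argument; the step function of rec_prim receives the index, then
   the previous value, then the parameters. *)
Fixpoint rec_eval n (f : recfun n) : n.-tuple nat -> nat -> Prop :=
  match f in recfun n return n.-tuple nat -> nat -> Prop with
  | rec_zero _ => fun _ y => y = 0%N
  | rec_succ => fun v y => y = (thead v).+1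
  | rec_proj _ i => fun v y => y = tnth v i
  | rec_comp m _ f g => fun v y =>
      exists2 w : m.-tuple nat,
        forall i, rec_eval (g i) v (tnth w i) & rec_eval f w y
  | rec_prim _ f g => fun v y =>
      exists s : nat -> nat,
        [/\ rec_eval f [tuple of behead v] (s 0%N),
            forall j, (j < thead v)%N ->
              rec_eval g [tuple of j :: s j :: behead v] (s j.+1)
          & y = s (thead v)]
  | rec_mu _ f => fun v y =>
      rec_eval f [tuple of y :: v] 0%N /\
      forall j, (j < y)%N -> exists z, rec_eval f [tuple of j :: v] z.+1
  end.

Definition rec_decidable k (P : seq nat -> Prop) :=
  exists f : recfun k, forall v : k.-tuple nat,
    (P v -> rec_eval f v 1%N) /\ (~ P v -> rec_eval f v 0%N).

Definition rec_enumerable (P : nat -> Prop) :=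
  exists f : recfun 1, forall n, P n <-> exists y, rec_eval f [tuple n] y.

Definition directed d (T : porderType d) (A : set T) :=
  A !=set0 /\
  forall x y, A x -> A y -> exists z, [/\ A z, x <= z & y <= z].

HB.mixin Record isDirectedComplete d T of Order.POrder d T := {
  directed_has_lub :
    forall A : set T, directed A -> supremums A !=set0
}.

#[short(type="cpoType")]
HB.structure Definition Cpo d :=
  {T of isDirectedComplete d T & Order.BPOrder d T}.

Definition scott_continuous d d' (D : porderType d) (E : porderType d')
    (f : D -> E) :=
  forall (A : set D) l, directed A -> supremums A l ->
    supremums (f @` A) (f l).

Record scott_fun d d' (D : porderType d) (E : porderType d') := ScottFun {
  scott_val :> D -> E;
  scott_valP : scott_continuous scott_val }.

Notation "{ 'scott' D -> E }" := (scott_fun D E)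
  (at level 0, D at level 98, E at level 99, format "{ 'scott'  D  ->  E }").

Section ScottFacts.
Context d d' d'' (D : porderType d) (E : porderType d') (F : porderType d'').

Lemma scott_mono (f : D -> E) :
  scott_continuous f -> forall x y, x <= y -> f x <= f y.
Proof.
move=> fc x y xy.
have dA : directed [set x; y].
  split; first by exists x; left.
  by move=> u v [->|->] [->|->]; exists y; split => //; right.
have sA : supremums [set x; y] y.
  by split=> [u [->|->] //|u uA]; apply: uA; right.
by have [+ _] := fc _ _ dA sA; apply; exists x => //; left.
Qed.

Lemma directed_image (f : D -> E) (A : set D) :
  (forall x y, x <= y -> f x <= f y) -> directed A -> directed (f @` A).
Proof.
move=> fm [[a Aa] dA]; split; first by exists (f a), a.
move=> _ _ [x Ax <-] [y Ay <-]; have [z [Az xz yz]] := dA _ _ Ax Ay.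
by exists (f z); split; [exists z|exact: fm|exact: fm].
Qed.

Lemma scott_const (c : E) : scott_continuous (fun _ : D => c).
Proof.
move=> A l [[a Aa] _] _; split; first by move=> _ [_ _ <-].
by move=> u; apply; exists a.
Qed.

Lemma scott_comp (g : E -> F) (f : D -> E) :
  scott_continuous g -> scott_continuous f -> scott_continuous (g \o f).
Proof.
move=> gc fc A l dA sA.
have := gc _ _ (directed_image (scott_mono fc) dA) (fc _ _ dA sA).
by rewrite image_comp.
Qed.

Lemma scott_fun_eq (f g : {scott D -> E}) : f =1 g -> f = g.
Proof.
case: f g => [f fc] [g gc] /= /funext fg.
by subst g; congr ScottFun; exact: Prop_irrelevance.
Qed.

End ScottFacts.

Fact scott_display : Order.disp_t.
Proof. exact: Order.Disp tt tt. Qed.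

Section ScottOrder.
Context d d' (D : porderType d) (E : porderType d').

HB.instance Definition _ := gen_eqMixin {scott D -> E}.
HB.instance Definition _ := gen_choiceMixin {scott D -> E}.

Definition scott_le (f g : {scott D -> E}) : bool :=
  `[< forall x, f x <= g x >].

Lemma scott_le_refl : reflexive scott_le.
Proof. by move=> f; apply/asboolP => x. Qed.

Lemma scott_le_anti : antisymmetric scott_le.
Proof.
move=> f g /andP[/asboolP fg /asboolP gf]; apply: scott_fun_eq => x.
by apply/eqP; rewrite eq_le fg gf.
Qed.

Lemma scott_le_trans : transitive scott_le.
Proof.
move=> g f h /asboolP fg /asboolP gh; apply/asboolP => x.
exact: le_trans (fg x) (gh x).
Qed.

HB.instance Definition _ := Order.Le_isPOrder.Build scott_display {scott D -> E}
  scott_le_refl scott_le_anti scott_le_trans.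

Lemma scott_leP (f g : {scott D -> E}) :
  reflect (forall x, f x <= g x) (f <= g).
Proof. exact: asboolP. Qed.

End ScottOrder.

Section ScottCpo.
Context d d' (D : porderType d) (E : cpoType d').

Definition scott_bot : {scott D -> E} := ScottFun (@scott_const _ _ D E \bot).

Lemma scott_bot_le (f : {scott D -> E}) : scott_bot <= f.
Proof. by apply/scott_leP => x; exact: le0x. Qed.

HB.instance Definition _ :=
  Order.hasBottom.Build scott_display {scott D -> E} scott_bot_le.

Definition eval_at (A : set {scott D -> E}) (x : D) : set E :=
  [set f x | f in A].

Lemma directed_eval_at (A : set {scott D -> E}) x :
  directed A -> directed (eval_at A x).
Proof. by apply: directed_image => f g /scott_leP. Qed.

Lemma scott_lub_subproof (A : set {scott D -> E}) : directed A ->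
  {s : D -> E | forall x, supremums (eval_at A x) (s x)}.
Proof.
move=> dA; have H x := cid (directed_has_lub _ (directed_eval_at x dA)).
by exists (fun x => sval (H x)) => x; case: (H x).
Qed.

Lemma scott_lub_continuous (A : set {scott D -> E}) (s : D -> E) :
  (forall x, supremums (eval_at A x) (s x)) -> scott_continuous s.
Proof.
move=> sP B l dB sB; split=> [_ [x Bx <-]|u uB].
  have [_] := sP x; apply => _ [f Af <-].
  have [+ _] := sP l => /(_ (f l)); move=> /(_ (ex_intro2 _ _ f Af erefl)).
  by apply: le_trans; apply: scott_mono; [exact: scott_valP|apply: sB.1].
have [_] := sP l; apply => _ [f Af <-].
have [_] := scott_valP f dB sB; apply => _ [x Bx <-].
apply: le_trans (uB (s x) _); last by exists x.
by have [+ _] := sP x; apply; exists f.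
Qed.

Lemma scott_pointwise_lub (A : set {scott D -> E}) (s : {scott D -> E}) :
  (forall x, supremums (eval_at A x) (s x)) -> supremums A s.
Proof.
move=> sP; split=> [f Af|g gA]; apply/scott_leP => x.
  by have [+ _] := sP x; apply; exists f.
by have [_] := sP x; apply => _ [f Af <-]; have /scott_leP := gA f Af; apply.
Qed.

Lemma scott_directed_has_lub (A : set {scott D -> E}) :
  directed A -> supremums A !=set0.
Proof.
move=> /scott_lub_subproof[s sP].
by exists (ScottFun (scott_lub_continuous sP)); exact: scott_pointwise_lub.
Qed.

HB.instance Definition _ :=
  isDirectedComplete.Build scott_display {scott D -> E} scott_directed_has_lub.

Lemma scott_lub_at (A : set {scott D -> E}) (s : {scott D -> E}) x :
  directed A -> supremums A s -> supremums (eval_at A x) (s x).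
Proof.
move=> dA sA; have [t tP] := scott_lub_subproof dA.
have tA := @scott_pointwise_lub A (ScottFun (scott_lub_continuous tP)) tP.
by rewrite (is_subset1_supremums sA tA); exact: tP.
Qed.

End ScottCpo.

Record lambda_model := LambdaModel {
  lm_disp : Order.disp_t;
  lm_dom :> cpoType lm_disp;
  lm_ap : {scott lm_dom -> {scott lm_dom -> lm_dom}};
  lm_lam : {scott {scott lm_dom -> lm_dom} -> lm_dom};
  lm_apK : forall f, lm_ap (lm_lam f) = f }.

Inductive term :=
| Var (x : nat)
| App (M N : term)
| Abs (x : nat) (M : term).

Section Interpretation.
Context (M : lambda_model).
Implicit Types (rho : nat -> M) (x : nat).

Definition env_set rho x (e : M) : nat -> M :=
  fun y => if y == x then e else rho y.

(* Below, nat -> M carries the pointwise order on functions (lefP). *)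

Lemma env_lub_at (A : set (nat -> M)) l x :
  supremums A l -> supremums [set rho x | rho in A] (l x).
Proof.
move=> [ub lub]; split=> [_ [rho Arho <-]|u uA].
  by have /lefP := ub _ Arho; apply.
have: l <= env_set l x u.
  apply: lub => rho Arho; apply/lefP => y; rewrite /env_set.
  case: eqP => [->|_]; first by apply: uA; exists rho.
  by have /lefP := ub _ Arho; apply.
by move=> /lefP/(_ x); rewrite /env_set eqxx.
Qed.

Lemma scott_env_get x : scott_continuous (fun rho => rho x).
Proof. by move=> A l _; exact: env_lub_at. Qed.

Lemma scott_env_set_val rho x : scott_continuous (env_set rho x).
Proof.
move=> A l [[a Aa] _] [ub lub]; split=> [_ [e Ae <-]|u uA]; apply/lefP => y.
  by rewrite /env_set; case: eqP => // _; exact: ub.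
have /lefP/(_ y) := uA _ (ex_intro2 _ _ a Aa erefl).
rewrite /env_set; case: eqP => // -> _; apply: lub => e Ae.
have /lefP/(_ x) := uA _ (ex_intro2 _ _ e Ae erefl).
by rewrite /env_set eqxx.
Qed.

Lemma scott_env_set_env x e : scott_continuous (fun rho => env_set rho x e).
Proof.
move=> A l [[a Aa] _] sA; split=> [_ [rho Arho <-]|u uA]; apply/lefP => y.
  rewrite /env_set; case: eqP => // _.
  by have /lefP := sA.1 _ Arho; apply.
have /lefP/(_ y) := uA _ (ex_intro2 _ _ a Aa erefl).
rewrite /env_set; case: eqP => // /eqP /negbTE yx _.
have [_] := env_lub_at y sA; apply => _ [rho Arho <-].
have /lefP/(_ y) := uA _ (ex_intro2 _ _ rho Arho erefl).
by rewrite /env_set yx.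
Qed.

Lemma scott_app (F G : (nat -> M) -> M) :
  scott_continuous F -> scott_continuous G ->
  scott_continuous (fun rho => lm_ap M (F rho) (G rho)).
Proof.
move=> Fc Gc.
have APc := scott_comp (scott_valP (lm_ap M)) Fc.
have mono rho rho' : rho <= rho' ->
    lm_ap M (F rho) (G rho) <= lm_ap M (F rho') (G rho').
  move=> le_rho; apply: (@le_trans _ _ (lm_ap M (F rho) (G rho'))).
    by apply: (scott_mono (scott_valP _)); exact: scott_mono Gc _ _ le_rho.
  by have /scott_leP := scott_mono APc le_rho; apply.
move=> A l dA sA; split=> [_ [rho Arho <-]|u uA].
  by apply: mono; exact: sA.1.
have dAP := directed_image (scott_mono APc) dA.
have [_] := scott_lub_at (G l) dAP (APc _ _ dA sA); apply.
move=> _ [_ [rho Arho <-] <-] /=.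
have [_] := scott_valP (lm_ap M (F rho)) (directed_image (scott_mono Gc) dA)
  (Gc _ _ dA sA); apply => _ [_ [rho' Arho' <-] <-].
have [tau [Atau le1 le2]] := dA.2 _ _ Arho Arho'.
apply: le_trans (uA _ (ex_intro2 _ _ tau Atau erefl)).
apply: (@le_trans _ _ (lm_ap M (F rho) (G tau))).
  by apply: (scott_mono (scott_valP _)); exact: scott_mono Gc _ _ le2.
by have /scott_leP := scott_mono APc le1; apply.
Qed.

Definition abs_body (F : {scott (nat -> M) -> M}) x rho : {scott M -> M} :=
  ScottFun (scott_comp (scott_valP F) (@scott_env_set_val rho x)).

Lemma scott_abs (F : {scott (nat -> M) -> M}) x :
  scott_continuous (fun rho => lm_lam M (abs_body F x rho)).
Proof.
apply: (scott_comp (scott_valP (lm_lam M))) => A l dA sA.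
apply: scott_pointwise_lub => e; rewrite /eval_at image_comp.
exact: (scott_comp (scott_valP F) (@scott_env_set_env x e)).
Qed.

(* Bundled with its continuity in the environment, so that the argument of
   lm_lam below is a continuous function. *)
Fixpoint interp (t : term) : {scott (nat -> M) -> M} :=
  match t with
  | Var x => ScottFun (@scott_env_get x)
  | App t u =>
      ScottFun (scott_app (scott_valP (interp t)) (scott_valP (interp u)))
  | Abs x t => ScottFun (@scott_abs (interp t) x)
  end.

Lemma interp_Var x rho : interp (Var x) rho = rho x.
Proof. by []. Qed.

Lemma interp_App t u rho :
  interp (App t u) rho = lm_ap M (interp t rho) (interp u rho).
Proof. by []. Qed.

Lemma interp_Abs x t rho (f : {scott M -> M}) :
  (forall e, f e = interp t (env_set rho x e)) ->
  interp (Abs x t) rho = lm_lam M f.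
Proof. by move=> fE; congr (lm_lam M _); apply: scott_fun_eq => e. Qed.

Definition order_theory : set (term * term) :=
  [set MN | forall rho, interp MN.1 rho <= interp MN.2 rho].

Definition theory : set (term * term) :=
  [set MN | forall rho, interp MN.1 rho = interp MN.2 rho].

End Interpretation.

Section PowersetCpo.
Context (G : Type).

Lemma supremums_bigcup (A : set (set G)) :
  supremums A (\bigcup_(X in A) X).
Proof.
split=> [X AX|U UA]; rewrite subsetEset; first exact: bigcup_sup.
by apply: bigcup_sub => X AX; rewrite -subsetEset; exact: UA.
Qed.

Lemma powerset_has_lub (A : set (set G)) : directed A -> supremums A !=set0.
Proof. by move=> _; exists (\bigcup_(X in A) X); exact: supremums_bigcup. Qed.

HB.instance Definition _ :=
  isDirectedComplete.Build _ (set G) powerset_has_lub.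

End PowersetCpo.

(* A choiceType is no restriction on the web: every type carries such a
   structure (gen_choiceMixin). *)
Record total_pair := TotalPair {
  web :> choiceType;
  web_infinite : infinite_set [set: web];
  web_code : {fset web} * web -> web;
  web_code_inj : injective web_code }.

Section GraphModel.
Context (G : total_pair).
Local Notation i a x := (web_code (a, x)).

Lemma finite_approx (f : {scott set G -> set G}) (Y : set G) x :
  f Y x <-> exists2 a : {fset G}, [set` a] `<=` Y & f [set` a] x.
Proof.
pose A := [set [set` a] | a in [set a : {fset G} | [set` a] `<=` Y]].
have dA : directed A.
  split; first by exists [set` fset0], fset0.
  move=> _ _ [a aY <-] [b bY <-]; exists [set` (a `|` b)%fset].
  split; rewrite ?subsetEset.
  - exists (a `|` b)%fset => // t; rewrite /= in_fsetU.
    by case/orP => [/aY|/bY].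
  - by move=> t /=; rewrite in_fsetU => ->.
  - by move=> t /=; rewrite in_fsetU => ->; rewrite orbT.
have sA : supremums A Y.
  suff -> : Y = \bigcup_(X in A) X by exact: supremums_bigcup.
  apply/seteqP; split=> [z Yz|z [_ [a aY <-]]]; last exact: aY.
  exists [set` [fset z]%fset]; last by rewrite /= inE.
  by exists [fset z]%fset => // t; rewrite /= inE => /eqP ->.
have fY := is_subset1_supremums (scott_valP f dA sA) (supremums_bigcup _).
rewrite fY; split=> [[_ [_ [a aY <-] <-]] fx|[a aY fx]]; first by exists a.
by exists (f [set` a]) => //; exists [set` a] => //; exists a.
Qed.

Definition gm_lam_val (f : {scott set G -> set G}) : set G :=
  [set b | exists a x, f [set` a] x /\ b = i a x].

Definition gm_ap_val (X Y : set G) : set G :=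
  [set x | exists2 a : {fset G}, [set` a] `<=` Y & X (i a x)].

Lemma fset_in_directed (A : set (set G)) (a : {fset G}) : directed A ->
  [set` a] `<=` \bigcup_(X in A) X -> exists2 X, A X & [set` a] `<=` X.
Proof.
move=> [[X0 AX0] dA].
move: {2}#|` a|%fset (leqnn #|` a|%fset) => n.
elim: n a => [|n IH] a le_an aA.
  move: le_an; rewrite leqn0 => /eqP/cardfs0_eq ->.
  by exists X0 => // t; rewrite /= in_fset0.
case: (fset_0Vmem a) => [->|[z za]].
  by exists X0 => // t; rewrite /= in_fset0.
have [||X AX aX] := IH (a `\ z)%fset.
- by move: le_an; rewrite (cardfsD1 z a) za.
- by move=> t /=; rewrite in_fsetD1 => /andP[_ ta]; exact: aA.
have [Z AZ Zz] := aA z za.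
have [W [AW]] := dA _ _ AX AZ; rewrite !subsetEset => XW ZW.
exists W => // t ta; case: (eqVneq t z) => [->|tz]; first exact: ZW.
by apply/XW/aX; rewrite /= in_fsetD1 tz.
Qed.

Lemma gm_ap_val_continuous X : scott_continuous (gm_ap_val X).
Proof.
move=> A l dA /is_subset1_supremums/(_ (supremums_bigcup A)) ->.
suff -> : gm_ap_val X (\bigcup_(Y in A) Y) =
          \bigcup_(Z in gm_ap_val X @` A) Z by exact: supremums_bigcup.
rewrite bigcup_image; apply/seteqP; split=> x.
  move=> [a aA Xa]; have [Y AY aY] := fset_in_directed dA aA.
  by exists Y => //; exists a.
by move=> [Y AY [a aY Xa]]; exists a => // z /aY Yz; exists Y.
Qed.

Definition gm_ap1 X : {scott set G -> set G} :=
  ScottFun (@gm_ap_val_continuous X).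

Lemma gm_ap_continuous : scott_continuous gm_ap1.
Proof.
move=> A l dA /is_subset1_supremums/(_ (supremums_bigcup A)) ->.
apply: scott_pointwise_lub => Y; rewrite /eval_at image_comp.
suff -> : gm_ap1 (\bigcup_(X in A) X) Y =
    \bigcup_(Z in ((fun f : {scott set G -> set G} => f Y) \o gm_ap1) @` A) Z.
  exact: supremums_bigcup.
rewrite bigcup_image; apply/seteqP; split=> x.
  by move=> [a aY [X AX Xa]]; exists X => //; exists a.
by move=> [X AX [a aY Xa]]; exists a => //; exists X.
Qed.

Definition gm_ap : {scott set G -> {scott set G -> set G}} :=
  ScottFun gm_ap_continuous.

Lemma gm_lam_continuous : scott_continuous gm_lam_val.
Proof.
move=> A l dA sA.
suff -> : gm_lam_val l = \bigcup_(Z in gm_lam_val @` A) Z.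
  exact: supremums_bigcup.
have lE a := is_subset1_supremums (scott_lub_at a dA sA) (supremums_bigcup _).
rewrite bigcup_image; apply/seteqP; split=> b.
  move=> [a [x []]]; rewrite lE => -[_ [f Af <-] fx] ->.
  by exists f => //; exists a, x.
move=> [f Af [a [x [fx ->]]]]; exists a, x; split=> //.
by rewrite lE; exists (f [set` a]) => //; exists f.
Qed.

Definition gm_lam : {scott {scott set G -> set G} -> set G} :=
  ScottFun gm_lam_continuous.

Lemma gm_apK f : gm_ap (gm_lam f) = f.
Proof.
apply: scott_fun_eq => Y; apply/seteqP; split=> x /=.
  move=> [a aY [b [y [fb /web_code_inj[ab xy]]]]].
  by apply/finite_approx; exists a => //; rewrite ab xy.
by move/finite_approx => [a aY fx]; exists a => //; exists a, x.
Qed.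

Definition graph_model : lambda_model := LambdaModel gm_apK.

End GraphModel.

Section EffectiveDomains.
Context d (D : cpoType d).

Definition compact_elt (k : D) :=
  forall (A : set D) l, directed A -> supremums A l -> k <= l ->
    exists2 x, A x & k <= x.

Record compacts := Compact {
  compact_val :> D;
  compact_valP : compact_elt compact_val }.

Definition bounded_complete :=
  forall A : set D, has_ubound A -> supremums A !=set0.

Definition omega_algebraic :=
  countable compact_elt /\
  forall x : D, let Kx := [set k | compact_elt k /\ k <= x] in
    directed Kx /\ supremums Kx x.

Definition scott_domain := bounded_complete /\ omega_algebraic.

Record effective_domain (num : nat -> compacts) : Prop := EffectiveDomain {
  ed_scott : scott_domain;
  ed_surj : forall k : D, compact_elt k -> exists n, k = num n;
  ed_bounded : rec_decidable 2 (fun v =>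
    if v is [:: m; n] then has_ubound [set (num m : D); (num n : D)]
    else False);
  ed_join : rec_decidable 3 (fun v =>
    if v is [:: m; n; k] then
      supremums [set (num m : D); (num k : D)] (num n : D)
    else False) }.

Context (num : nat -> compacts).

Definition re_elt (x : D) := rec_enumerable (fun n => (num n : D) <= x).

Definition dec_elt (x : D) :=
  rec_decidable 1 (fun v => if v is [:: n] then (num n : D) <= x else False).

Lemma bot_compact : compact_elt \bot.
Proof. by move=> A l [[a Aa] _] _ _; exists a => //; exact: le0x. Qed.

Lemma directed_finite_ubound (A B : set D) l :
  finite_set A -> A `<=` compact_elt -> ubound A l ->
  directed B -> supremums B l -> exists2 x, B x & ubound A x.
Proof.
move=> /finite_seqP[s ->]; elim: s => [|a s IH] cA uA dB sB.
  by have [[b Bb] _] := dB; exists b.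
have [||x Bx xA] := IH _ _ dB sB.
- by move=> z zs; apply: cA; rewrite /= inE zs orbT.
- by move=> z zs; apply: uA; rewrite /= inE zs orbT.
have as_ : [set` a :: s] a by rewrite /= inE eqxx.
have [y By ay] := cA a as_ _ _ dB sB (uA a as_).
have [z [Bz xz yz]] := dB.2 _ _ Bx By.
exists z => // t; rewrite /= inE => /orP[/eqP ->|ts]; first exact: le_trans yz.
exact: le_trans (xA t ts) xz.
Qed.

Lemma compact_supremum (A : set D) :
  finite_set A -> A `<=` compact_elt -> compact_elt (supremum \bot A).
Proof.
move=> finA cA; rewrite /supremum; case: ifPn => _; first exact: bot_compact.
case: xgetP => [s _ [As sA]|_]; last exact: bot_compact.
move=> B l dB sB sl.
have Al : ubound A l by move=> a /As as_; exact: le_trans sl.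
have [x Bx xA] := directed_finite_ubound finA cA Al dB sB.
by exists x => //; exact: sA.
Qed.

End EffectiveDomains.

Definition cantor_pair (p : nat * nat) : nat := 'C((p.1 + p.2).+1, 2) + p.2.

(* The n-th finite set of pairs: the positions of the bits 1 of n are the codes
   of its elements. *)
Definition pair_set (n : nat) : set (nat * nat) :=
  [set p | odd (n %/ 2 ^ cantor_pair p)].

Lemma finite_pair_set n : finite_set (pair_set n).
Proof.
apply: (@sub_finite_set _ _ (`I_n `*` `I_n)); last exact: finite_setX.
move=> [m k]; rewrite /pair_set /cantor_pair /= => bit.
have lt_n : (cantor_pair (m, k) < n)%N.
  rewrite ltnNge; apply/negP => le_n; move: bit.
  by rewrite divn_small //; apply: leq_ltn_trans le_n _; exact: ltn_expl.
have le_mk : (m + k <= 'C((m + k).+1, 2))%N by rewrite binS bin1 leq_addl.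
by rewrite /cantor_pair /= in lt_n; split => /=; lia.
Qed.

Section FunctionSpace.
Context d d' (D : cpoType d) (E : cpoType d').

Definition step_val (a : D) (b : E) (x : D) : E := if a <= x then b else \bot.

Lemma step_continuous (a : compacts D) b : scott_continuous (step_val a b).
Proof.
move=> A l dA sA; rewrite /step_val; split=> [_ [x Ax <-]|u uA].
  case: ifP => [ax|_]; last exact: le0x.
  by rewrite (le_trans ax) //; exact: sA.1.
case: ifP => [al|_]; last exact: le0x.
have [x Ax ax] := compact_valP dA sA al.
by apply: uA; exists x => //; rewrite ax.
Qed.

Definition step (a : compacts D) (b : E) : {scott D -> E} :=
  ScottFun (@step_continuous a b).

Lemma step_compact (a : compacts D) (b : compacts E) :
  compact_elt (step a b).
Proof.
move=> A l dA sA /scott_leP/(_ (a : D)); rewrite /= /step_val lexx => bl.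
have [_ [f Af <-] bf] :=
  compact_valP (directed_eval_at (a : D) dA) (scott_lub_at (a : D) dA sA) bl.
exists f => //; apply/scott_leP => x /=; rewrite /step_val.
case: ifP => [ax|_]; last exact: le0x.
by apply: le_trans bf _; exact: (scott_mono (scott_valP f)).
Qed.

Context (num : nat -> compacts D) (num' : nat -> compacts E).

Definition consistent (I : set (nat * nat)) :=
  forall J, J `<=` I ->
    has_ubound [set (num p.1 : D) | p in J] ->
    has_ubound [set (num' p.2 : E) | p in J].

Definition steps (I : set (nat * nat)) : set {scott D -> E} :=
  [set step (num p.1) (num' p.2) | p in I].

(* supremum defaults to \bot when there is no least upper bound; for consistent
   I there is one as soon as E is bounded complete. *)
Definition fun_num_val (n : nat) : {scott D -> E} :=
  if pselect (consistent (pair_set n)) then supremum \bot (steps (pair_set n))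
  else \bot.

Lemma fun_num_compact n : compact_elt (fun_num_val n).
Proof.
rewrite /fun_num_val; case: pselect => /= _; last exact: bot_compact.
apply: compact_supremum; first exact/finite_image/finite_pair_set.
by move=> f [p _ <-]; exact: step_compact.
Qed.

Definition fun_num (n : nat) : compacts {scott D -> E} :=
  Compact (@fun_num_compact n).

End FunctionSpace.

Section EffectiveModels.
Context (M : lambda_model).

Definition weakly_effective_with (num : nat -> compacts M) :=
  [/\ effective_domain num,
      re_elt (fun_num num (fun_num num num)) (lm_ap M)
    & re_elt (fun_num (fun_num num num) num) (lm_lam M)].

Definition apps (u : M) (es : seq M) : M := foldl (fun u e => lm_ap M u e) u es.

(* In the last clause, decidability of f d for compact d is uniform in d: the
   set of pairs (m, n) with num n <= f (num m) is decidable. With decidability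
   of each f d separately, no graph model would be effective. For instance, for
   an r.e. undecidable set K of elements of the web, let f X be a fixed
   singleton {b} if X meets K and empty otherwise; then f is r.e. and each f X
   is finite, but i({x}, b) belongs to lm_lam f if and only if x is in K. *)
Definition effective_with (num : nat -> compacts M) :=
  [/\ weakly_effective_with num,
      forall (k : compacts M) (es : seq M),
        List.Forall (dec_elt num) es -> dec_elt num (apps k es)
    & forall f : {scott M -> M}, re_elt (fun_num num num) f ->
        rec_decidable 2 (fun v =>
          if v is [:: m; n] then (num n : M) <= f (num m : M) else False) ->
        dec_elt num (lm_lam M f)].

Definition effective := exists num, effective_with num.

End EffectiveModels.

(* Main.v *)
(* The web is the free completion of the disjoint union of all finite partial pairs, coded on the
   natural numbers so that the graph of its coding map is given by a formula with bounded
   quantifiers; this makes the model effective. For minimality, let [x] be in the interpretation of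
   [M] in some graph model over [G'] but not in that of [N]. A derivation of the former uses
   finitely many elements of [G'] and values of its coding map, that is, a finite partial pair,
   which is the k-th one for some [k]; this embedding phi into the free completion carries the
   derivation over. Conversely there is a partial map psi from the free completion to [G'],
   defined on the elements generated by the k-th pair over arbitrary finite sets, which is a left
   inverse of phi and satisfies psi(i(a, x)) = i'(psi[a], psi(x)), one side being defined if and
   only if the other is; it carries interpretations back, so phi(x) is not in the interpretation
   of [N]. *)
From mathcomp Require Import all_boot all_order finmap zify.
From mathcomp Require Import boolp functions cardinality.
Require Import Defs.
From mathcomp Require Import classical_sets.

Set Implicit Arguments.
Unset Strict Implicit.
Unset Printing Implicit Defensive.

(** * Computable functions and decidable predicates *)

Lemma rec_eval_det k (f : recfun k) v y z :
  rec_eval f v y -> rec_eval f v z -> y = z.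
Proof.
elim: f v y z => {k} /= [n|| n i|m n f IHf g IHg|n f IHf g IHg|n f IHf] v y z.
- by move=> -> ->.
- by move=> -> ->.
- by move=> -> ->.
- move=> [w gw fw] [w' gw' fw']; apply: IHf fw _.
  suff -> : w = w' by [].
  by apply: eq_from_tnth => i; apply: IHg (gw i) (gw' i).
- move=> [s [s0 sS ->]] [t [t0 tS ->]].
  suff H j : j <= thead v -> s j = t j by exact: H.
  elim: j => [_|j IH jv]; first exact: IHf s0 t0.
  by apply: IHg (sS _ jv) _; rewrite IH ?(ltnW jv) //; apply: tS.
- move=> [fy yP] [fz zP].
  have [yz|zy|//] := ltngtP y z.
    by have [u fu] := zP _ yz; have := IHf _ _ _ fy fu.
  by have [u fu] := yP _ zy; have := IHf _ _ _ fz fu.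
Qed.

(* Environments are functions, so that shifting de Bruijn indices under a binder is a conversion. *)
Definition computable k (F : (nat -> nat) -> nat) :=
  exists f : recfun k, forall v : k.-tuple nat, rec_eval f v (F (nth 0 v)).

Lemma computable_var k i : i < k -> computable k (fun e => e i).
Proof. by move=> ik; exists (rec_proj (Ordinal ik)) => v /=; rewrite (tnth_nth 0). Qed.

Lemma computable_comp k G (Fs : seq ((nat -> nat) -> nat)) :
  computable (size Fs) G ->
  (forall i, i < size Fs -> computable k (nth (fun=> 0) Fs i)) ->
  computable k (fun e => G (nth 0 [seq F e | F <- Fs])).
Proof.
move=> [g gP] FsP.
have [f fP] := choice (fun i : 'I_(size Fs) => FsP i (ltn_ord i)).
exists (rec_comp g f) => v /=.
have sz : size [seq F (nth 0 v) | F <- Fs] == size Fs by rewrite size_map.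
exists (Tuple sz); last exact: gP.
move=> i; rewrite (tnth_nth 0) /= (nth_map (fun=> 0)) //; exact: fP.
Qed.

Lemma computable_comp1 k g A : computable 1 (fun e => g (e 0)) ->
  computable k A -> computable k (fun e => g (A e)).
Proof.
by move=> gP AP; apply: (computable_comp (G := fun e => g (e 0)) (Fs := [:: A])) => // -[].
Qed.

Lemma computable_comp2 k g A B : computable 2 (fun e => g (e 0) (e 1)) ->
  computable k A -> computable k B -> computable k (fun e => g (A e) (B e)).
Proof.
by move=> gP AP BP;
  apply: (computable_comp (G := fun e => g (e 0) (e 1)) (Fs := [:: A; B])) => // -[|[]].
Qed.

Lemma computable_comp3 k g A B C : computable 3 (fun e => g (e 0) (e 1) (e 2)) ->
  computable k A -> computable k B -> computable k C ->
  computable k (fun e => g (A e) (B e) (C e)).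
Proof.
by move=> gP AP BP CP;
  apply: (computable_comp (G := fun e => g (e 0) (e 1) (e 2)) (Fs := [:: A; B; C])) => // -[|[|[]]].
Qed.

Lemma computable_comp4 k g A B C D :
  computable 4 (fun e => g (e 0) (e 1) (e 2) (e 3)) ->
  computable k A -> computable k B -> computable k C -> computable k D ->
  computable k (fun e => g (A e) (B e) (C e) (D e)).
Proof.
by move=> gP AP BP CP DP;
  apply: (computable_comp (G := fun e => g (e 0) (e 1) (e 2) (e 3))
            (Fs := [:: A; B; C; D])) => // -[|[|[|[]]]].
Qed.

Lemma computable0 k : computable k (fun=> 0).
Proof. by exists (rec_zero k). Qed.

Lemma computableS k A : computable k A -> computable k (fun e => (A e).+1).
Proof.
by apply: computable_comp1; exists rec_succ => v /=; case/tupleP: v.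
Qed.

Lemma computable_const k n : computable k (fun=> n).
Proof. by elim: n => [|n]; [exact: computable0|exact: computableS]. Qed.

Definition vars m n : seq ((nat -> nat) -> nat) := [seq (fun e => e i) | i <- iota m n].

Lemma size_vars m n : size (vars m n) = n.
Proof. by rewrite size_map size_iota. Qed.

Lemma computable_vars k m n i : m + n <= k -> i < n ->
  computable k (nth (fun=> 0) (vars m n) i).
Proof.
move=> mnk ilt; rewrite (nth_map 0) ?size_iota // nth_iota //.
by apply: computable_var; lia.
Qed.

Lemma nth_vars (s : seq nat) m n i : size s = m + n ->
  nth 0 [seq F (nth 0 s) | F <- vars m n] i = nth 0 s (m + i).
Proof.
move=> sz; rewrite -map_comp; have [ilt|ige] := ltnP i n.
  by rewrite (nth_map 0) ?size_iota //= nth_iota.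
by rewrite !nth_default ?size_map ?size_iota // sz leq_add2l.
Qed.

Lemma computable_shift k F : computable k F ->
  computable k.+1 (fun e => F (fun i => e i.+1)).
Proof.
move=> FP; have [|i|r rP] := @computable_comp k.+1 F (vars 1 k).
- by rewrite size_vars.
- by rewrite size_vars => ik; exact: computable_vars.
exists r => v; have := rP v; congr (rec_eval _ _ (F _)).
by apply/funext => i; rewrite nth_vars ?size_tuple.
Qed.

Lemma computable_iteri k (N F : (nat -> nat) -> nat) G :
  computable k N -> computable k F ->
  computable k.+2 (fun e => G (e 0) (e 1) (fun i => e i.+2)) ->
  computable k (fun e => iteri (N e) (fun j r => G j r e) (F e)).
Proof.
move=> NP [f fP] [g gP].
pose R e := iteri (e 0) (fun j r => G j r (fun i => e i.+1)) (F (fun i => e i.+1)).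
have RP : computable k.+1 R.
  exists (rec_prim f g) => v; case/tupleP: v => x v /=.
  exists (fun n => iteri n (fun j r => G j r (nth 0 v)) (F (nth 0 v))); split.
  - by rewrite (_ : [tuple of _] = v); [exact: fP|exact/val_inj].
  - move=> j _; set s := iteri j _ _.
    have := gP [tuple of j :: s :: v]; congr (rec_eval _ _ _); exact: val_inj.
  - by [].
pose Fs := N :: vars 0 k.
have sFs : size Fs = k.+1 by rewrite /= size_vars.
have [|i|r rP] := @computable_comp k R Fs.
- by rewrite sFs.
- rewrite sFs; case: i => [//|i] ik /=.
  exact: computable_vars.
exists r => v; have := rP v; congr (rec_eval _ _ _).
rewrite /R /=; suff -> : nth 0 [seq F (nth 0 v) | F <- vars 0 k] = nth 0 v by [].
by apply/funext => i; rewrite nth_vars ?size_tuple.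
Qed.

Lemma computable_pred k A : computable k A -> computable k (fun e => (A e).-1).
Proof.
apply: computable_comp1.
have -> : (fun e : nat -> nat => (e 0).-1) = fun e => iteri (e 0) (fun j _ => j) 0.
  by apply/funext => e; case: (e 0).
by apply: (computable_iteri (G := fun j _ _ => j));
  [exact: computable_var|exact: computable0|exact: computable_var].
Qed.

Lemma computable_add k A B : computable k A -> computable k B ->
  computable k (fun e => A e + B e).
Proof.
apply: computable_comp2.
have -> : (fun e : nat -> nat => e 0 + e 1) = fun e => iteri (e 0) (fun _ r => r.+1) (e 1).
  by apply/funext => e; elim: (e 0) => [//|n IH]; rewrite addSn IH.
apply: (computable_iteri (G := fun _ r _ => r.+1)); try exact: computable_var.
exact/computableS/computable_var.
Qed.

Lemma computable_sub k A B : computable k A -> computable k B ->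
  computable k (fun e => A e - B e).
Proof.
apply: computable_comp2.
have -> : (fun e : nat -> nat => e 0 - e 1) = fun e => iteri (e 1) (fun _ r => r.-1) (e 0).
  by apply/funext => e; elim: (e 1) => [|n IH]; rewrite ?subn0 // subnS IH.
apply: (computable_iteri (G := fun _ r _ => r.-1)); try exact: computable_var.
exact/computable_pred/computable_var.
Qed.

Lemma computable_mul k A B : computable k A -> computable k B ->
  computable k (fun e => A e * B e).
Proof.
apply: computable_comp2.
have -> : (fun e : nat -> nat => e 0 * e 1) = fun e => iteri (e 0) (fun _ r => r + e 1) 0.
  by apply/funext => e; elim: (e 0) => [|n IH] //; rewrite mulSn addnC IH.
apply: (computable_iteri (G := fun _ r e => r + e 1)); try exact: computable_var.
  exact: computable0.
by apply: computable_add; exact: computable_var.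
Qed.

Lemma computable_exp2 k A : computable k A -> computable k (fun e => 2 ^ A e).
Proof.
apply: (computable_comp1 (g := fun a => 2 ^ a)).
have -> : (fun e : nat -> nat => 2 ^ e 0) = fun e => iteri (e 0) (fun _ r => 2 * r) 1.
  by apply/funext => e; elim: (e 0) => [|n IH] //; rewrite expnS IH.
apply: (computable_iteri (G := fun _ r e => 2 * r)); try exact: computable_const.
  exact: computable_var.
by apply: computable_mul; [exact: computable_const|exact: computable_var].
Qed.

Lemma computable_bin2 k A : computable k A -> computable k (fun e => 'C(A e, 2)).
Proof.
apply: (computable_comp1 (g := fun a => 'C(a, 2))).
have -> : (fun e : nat -> nat => 'C(e 0, 2)) = fun e => iteri (e 0) (fun j r => r + j) 0.
  by apply/funext => e; elim: (e 0) => [|n IH] //; rewrite binS bin1 IH.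
apply: (computable_iteri (G := fun j r e => r + j)); try exact: computable_const.
  exact: computable_var.
by apply: computable_add; exact: computable_var.
Qed.

Definition decidable_in k (P : (nat -> nat) -> Prop) :=
  computable k (fun e => `[<P e>] : nat).

Lemma decidable_in_ext k (P Q : (nat -> nat) -> Prop) :
  (forall e, P e <-> Q e) -> decidable_in k P -> decidable_in k Q.
Proof. by move=> PQ; suff -> : P = Q by []; apply/funext => e; exact/propext. Qed.

Lemma decidable_in_comp2 k (g : nat -> nat -> Prop) A B :
  decidable_in 2 (fun e => g (e 0) (e 1)) ->
  computable k A -> computable k B -> decidable_in k (fun e => g (A e) (B e)).
Proof. exact: (@computable_comp2 k (fun a b => `[<g a b>])). Qed.

Lemma decidable_in_comp3 k (g : nat -> nat -> nat -> Prop) A B C :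
  decidable_in 3 (fun e => g (e 0) (e 1) (e 2)) ->
  computable k A -> computable k B -> computable k C ->
  decidable_in k (fun e => g (A e) (B e) (C e)).
Proof. exact: (@computable_comp3 k (fun a b c => `[<g a b c>])). Qed.

Lemma decidable_in_comp4 k (g : nat -> nat -> nat -> nat -> Prop) A B C D :
  decidable_in 4 (fun e => g (e 0) (e 1) (e 2) (e 3)) ->
  computable k A -> computable k B -> computable k C -> computable k D ->
  decidable_in k (fun e => g (A e) (B e) (C e) (D e)).
Proof. exact: (@computable_comp4 k (fun a b c d => `[<g a b c d>])). Qed.

Lemma decidable_in_not k P : decidable_in k P -> decidable_in k (fun e => ~ P e).
Proof.
rewrite /decidable_in; under [X in _ -> computable _ X]eq_fun do rewrite asbool_neg.
move=> PP; have -> : (fun e => ~~ `[<P e>] : nat) = fun e => 1 - `[<P e>].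
  by apply/funext => e; case: asboolP.
by apply: computable_sub => //; exact: computable_const.
Qed.

Lemma decidable_in_and k P Q : decidable_in k P -> decidable_in k Q ->
  decidable_in k (fun e => P e /\ Q e).
Proof.
rewrite /decidable_in => PP QP.
have -> : (fun e => `[<P e /\ Q e>] : nat) = fun e => `[<P e>] * `[<Q e>].
  by apply/funext => e; rewrite asbool_and mulnb.
exact: computable_mul.
Qed.

Lemma decidable_in_or k P Q : decidable_in k P -> decidable_in k Q ->
  decidable_in k (fun e => P e \/ Q e).
Proof.
move=> PP QP.
apply: (@decidable_in_ext _ (fun e => ~ (~ P e /\ ~ Q e))) => [e|].
  by rewrite not_andE !notE.
by apply/decidable_in_not/decidable_in_and; exact: decidable_in_not.
Qed.

Lemma decidable_in_impl k P Q : decidable_in k P -> decidable_in k Q ->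
  decidable_in k (fun e => P e -> Q e).
Proof.
move=> PP QP; apply: (@decidable_in_ext _ (fun e => ~ P e \/ Q e)) => [e|].
  by rewrite implyE.
by apply: decidable_in_or => //; exact: decidable_in_not.
Qed.

Lemma decidable_in_iff k P Q : decidable_in k P -> decidable_in k Q ->
  decidable_in k (fun e => P e <-> Q e).
Proof. by move=> PP QP; apply: decidable_in_and; exact: decidable_in_impl. Qed.

Lemma decidable_in_le k A B : computable k A -> computable k B ->
  decidable_in k (fun e => A e <= B e).
Proof.
move=> AP BP; rewrite /decidable_in.
have -> : (fun e => `[<A e <= B e>] : nat) = fun e => 1 - (A e - B e).
  by apply/funext => e; rewrite asboolb; lia.
apply: computable_sub; first exact: computable_const.
exact: computable_sub.
Qed.

Lemma decidable_in_eq k A B : computable k A -> computable k B ->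
  decidable_in k (fun e => A e = B e).
Proof.
move=> AP BP; apply: (@decidable_in_ext _ (fun e => A e <= B e /\ B e <= A e)) => [e|].
  by split=> [|->//]; lia.
by apply: decidable_in_and; exact: decidable_in_le.
Qed.

Lemma decidable_in_exists k B P : computable k B ->
  (forall e j, P j e -> j <= B e) ->
  decidable_in k.+1 (fun e => P (e 0) (fun i => e i.+1)) ->
  decidable_in k (fun e => exists j, P j e).
Proof.
move=> BP leB PP; rewrite /decidable_in.
have -> : (fun e => `[<exists j, P j e>] : nat) =
    fun e => iteri (B e).+1 (fun j r => 1 - (1 - r) * (1 - `[<P j e>])) 0.
  apply/funext => e.
  have H n : iteri n (fun j r => 1 - (1 - r) * (1 - `[<P j e>])) 0 =
             `[<exists j, j < n /\ P j e>].
    elim: n => [|n /= ->]; first by case: asboolP => // -[j []].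
    case: asboolP => [[j [jn Pj]]|nP].
      by rewrite mul0n; case: asboolP => // -[]; exists j; split=> //; lia.
    rewrite mul1n; case: asboolP => Pn.
      by case: asboolP => // -[]; exists n.
    case: asboolP => // -[j [jn Pj]]; case: nP; exists j; split=> //.
    rewrite ltn_neqAle -ltnS jn andbT; apply/eqP => jn'; apply: Pn.
    by rewrite -jn'.
  rewrite H; congr nat_of_bool; apply: asbool_equiv_eq; split => -[j].
    by move=> Pj; exists j; split=> //; rewrite ltnS leB.
  by case=> _ Pj; exists j.
apply: (computable_iteri (G := fun j r e => 1 - (1 - r) * (1 - `[<P j e>]))).
- exact: computableS.
- exact: computable0.
- apply: computable_sub; first exact: computable_const.
  apply: computable_mul; apply: computable_sub; try exact: computable_const.
    exact: computable_var.
  have [|i|r rP] := @computable_comp k.+2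
     (fun e => `[<P (e 0) (fun i => e i.+1)>] : nat) ((fun e => e 0) :: vars 2 k).
  + by rewrite /= size_vars.
  + rewrite /= size_vars; case: i => [|i] ik /=; first exact: computable_var.
    exact: computable_vars.
  exists r => v; have := rP v; congr (rec_eval _ _ (nat_of_bool `[<P _ _>])).
  by apply/funext => i /=; rewrite nth_vars ?size_tuple.
Qed.

Lemma decidable_in_forall k B P : computable k B ->
  (forall e j, ~ P j e -> j <= B e) ->
  decidable_in k.+1 (fun e => P (e 0) (fun i => e i.+1)) ->
  decidable_in k (fun e => forall j, P j e).
Proof.
move=> BP leB PP.
apply: (@decidable_in_ext _ (fun e => ~ exists j, ~ P j e)) => [e|].
  split=> [nP j|P' [j]]; last by apply; exact: P'.
  by apply: contrapT => nPj; apply: nP; exists j.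
apply/decidable_in_not/(decidable_in_exists BP) => [e j|]; first exact: leB.
exact: decidable_in_not.
Qed.

Lemma rec_decidable1 (P : nat -> Prop) : decidable_in 1 (fun e => P (e 0)) ->
  rec_decidable 1 (fun v => if v is [:: n] then P n else False).
Proof.
move=> [f fP]; exists f => -[[|a []] //= sv]; have := fP (@Tuple 1 _ [:: a] sv) => /=.
by case: asboolP => Pa ev; split.
Qed.

Lemma rec_decidable2 (P : nat -> nat -> Prop) :
  decidable_in 2 (fun e => P (e 0) (e 1)) ->
  rec_decidable 2 (fun v => if v is [:: m; n] then P m n else False).
Proof.
move=> [f fP]; exists f => -[[|a [|b []]] //= sv]; have := fP (@Tuple 2 _ [:: a; b] sv) => /=.
by case: asboolP => Pa ev; split.
Qed.

Lemma rec_decidable3 (P : nat -> nat -> nat -> Prop) :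
  decidable_in 3 (fun e => P (e 0) (e 1) (e 2)) ->
  rec_decidable 3 (fun v => if v is [:: m; n; k] then P m n k else False).
Proof.
move=> [f fP]; exists f => -[[|a [|b [|c []]]] //= sv].
have /= := fP (@Tuple 3 _ [:: a; b; c] sv).
by case: asboolP => Pa ev; split.
Qed.

Lemma rec_decidable2_inv (P : nat -> nat -> Prop) :
  rec_decidable 2 (fun v => if v is [:: m; n] then P m n else False) ->
  decidable_in 2 (fun e => P (e 0) (e 1)).
Proof.
move=> [f fP]; exists f => -[[|a [|b []]] //= sv].
have [Pab nPab] := fP (@Tuple 2 _ [:: a; b] sv).
by case: asboolP => [/Pab|/nPab].
Qed.

Lemma rec_enumerable_decidable (P : nat -> Prop) :
  decidable_in 1 (fun e => P (e 0)) -> rec_enumerable P.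
Proof.
move=> PP.
have [f fP] : computable 2 (fun e => 1 - `[<P (e 1)>]).
  apply: computable_sub; first exact: computable_const.
  by apply: (@computable_comp1 _ (fun a => `[<P a>]) (fun e => e 1)) => //; exact: computable_var.
exists (rec_mu f) => n; split=> [Pn|[y [fy _]]].
  by exists 0; split=> //=; have := fP [tuple 0; n] => /=; case: asboolP.
have := rec_eval_det fy (fP [tuple of y :: [tuple n]]).
by rewrite /=; case: asboolP.
Qed.

(** * The web *)

Definition bit z m := odd (m %/ 2 ^ z).

Lemma bit0n z : bit z 0 = false.
Proof. by rewrite /bit div0n. Qed.

Lemma bit0 m : bit 0 m = odd m.
Proof. by rewrite /bit divn1. Qed.

Lemma bitS z m : bit z.+1 m = bit z m./2.
Proof. by rewrite /bit expnS divnMA divn2. Qed.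

Lemma bit_lt z m : bit z m -> z < m.
Proof.
rewrite /bit ltnNge; apply: contraTN => mz.
by rewrite divn_small //; apply: leq_ltn_trans mz _; exact: ltn_expl.
Qed.

Lemma leq_bit m n : (forall z, bit z m -> bit z n) -> m <= n.
Proof.
elim/ltn_ind: m n => -[//|m] IH n sub.
have half : m.+1./2 <= n./2.
  apply: IH => [|z]; first by rewrite -divn2 ltn_Pdiv.
  by rewrite -!bitS; exact: sub.
have := sub 0; rewrite !bit0.
rewrite -{2}(odd_double_half m.+1) -{2}(odd_double_half n) => sub0.
by rewrite leq_add ?leq_double //; case: (odd m.+1) sub0 => [->|].
Qed.

Lemma eq_bit m n : bit^~ m =1 bit^~ n -> m = n.
Proof.
by move=> mn; apply/eqP; rewrite eqn_leq; apply/andP; split; apply: leq_bit => z; rewrite mn.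
Qed.

Lemma ltn_exp2_bit B m : (forall z, bit z m -> z < B) -> m < 2 ^ B.
Proof.
elim: B m => [|B IH] m mB.
  suff -> : m = 0 by [].
  by apply: eq_bit => z; rewrite bit0n; apply/negP => /mB.
have /IH : forall z, bit z m./2 -> z < B by move=> z; rewrite -bitS => /mB.
by rewrite expnS -{2}(odd_double_half m); case: (odd m); lia.
Qed.

Fixpoint encode N (P : pred nat) :=
  if N is N'.+1 then P 0 + (encode N' (fun z => P z.+1)).*2 else 0.

Lemma bit_encode N P z : bit z (encode N P) = (z < N) && P z.
Proof.
elim: N P z => [|N IH] P [|z] /=; rewrite ?bit0n //.
  by rewrite bit0 oddD odd_double addbF oddb.
by rewrite bitS half_bit_double IH.
Qed.

Lemma bit_exp2 z x : bit z (2 ^ x) = (z == x).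
Proof.
suff -> : 2 ^ x = encode x.+1 (pred1 x).
  by rewrite bit_encode /=; case: eqP => [->|_]; rewrite ?ltnSn ?andbF.
elim: x => [//|x IH]; rewrite expnS IH mul2n; congr (_.*2).
Qed.

Definition code (a : {fset nat}) := encode (\max_(x <- a) x).+1 (fun x => x \in a).

Lemma bit_code a z : bit z (code a) = (z \in a).
Proof.
rewrite bit_encode ltnS; case za: (z \in a); last by rewrite andbF.
by rewrite andbT; apply: leq_bigmax_seq.
Qed.

Definition bits m : {fset nat} := [fset x in iota 0 m | bit x m]%fset.

Lemma in_bits m x : (x \in bits m) = bit x m.
Proof.
rewrite !inE /= mem_iota add0n leq0n /=.
by apply/andP/idP => [[]//|bx]; split=> //; exact: bit_lt.
Qed.

Lemma bitsK m : code (bits m) = m.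
Proof. by apply: eq_bit => z; rewrite bit_code in_bits. Qed.

Lemma codeK a : bits (code a) = a.
Proof. by apply/fsetP => z; rewrite in_bits bit_code. Qed.

Definition cpair m n := cantor_pair (m, n).

Lemma cpair_ge m n : m + n <= cpair m n.
Proof. by rewrite /cpair /cantor_pair /= binS bin1; lia. Qed.

Lemma leq_cpair m n m' n' : m <= m' -> n <= n' -> cpair m n <= cpair m' n'.
Proof.
move=> mm nn; rewrite /cpair /cantor_pair /=.
by apply: leq_add => //; apply: leq_bin2l; lia.
Qed.

Lemma cpair_inj m n m' n' : cpair m n = cpair m' n' -> m = m' /\ n = n'.
Proof.
rewrite /cpair /cantor_pair /= => E.
suff s : m + n = m' + n' by move: E; rewrite s; lia.
wlog lt : m n m' n' E / m + n < m' + n'.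
  move=> H; have [lt|lt|//] := ltngtP (m + n) (m' + n'); first exact: H lt.
  by apply/esym/H/lt.
exfalso; have := @leq_bin2l (m + n).+2 (m' + n').+1 2 lt.
by rewrite [in X in X <= _]binS bin1; lia.
Qed.

(* The web is [nat]. A number [k] is read, through its bits, as the table of a finite partial pair
   on [nat], and [gen k e] is the element [e] of the [k]-th such pair; [form m x] is the new
   element that the free completion adds for the pair (bits m, x). *)
Definition gen k e := (cpair k e).*2.

Definition form m x := (cpair m x).*2.+1.

Lemma gen_inj k e k' e' : gen k e = gen k' e' -> k = k' /\ e = e'.
Proof. by move/double_inj/cpair_inj. Qed.

Lemma form_inj m x m' x' : form m x = form m' x' -> m = m' /\ x = x'.
Proof. by case=> /double_inj/cpair_inj. Qed.

Lemma gen_form k e m x : gen k e <> form m x.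
Proof. by rewrite /gen /form; lia. Qed.

Lemma gen_ge k e : k + e <= gen k e.
Proof. by have := cpair_ge k e; rewrite /gen; lia. Qed.

Lemma form_gt m x : m + x < form m x.
Proof. by have := cpair_ge m x; rewrite /form; lia. Qed.

(* Discarding the entries that share one of their two components with another entry makes every
   table a partial injection. *)
Definition entry k y a e :=
  bit (cpair y (cpair a e)) k /\
  forall y' a' e', bit (cpair y' (cpair a' e')) k -> (y = y' <-> a = a' /\ e = e').

Definition defined_by k y m x := exists e a,
  [/\ x = gen k e,
      forall u, bit u m -> exists j, bit j a /\ u = gen k j,
      forall j, bit j a -> bit (gen k j) m
    & entry k y a e].

Definition code_graph m x z :=
  (exists k y, defined_by k y m x /\ z = gen k y) \/
  (~ exists k y, defined_by k y m x) /\ z = form m x.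

Lemma entry_lt k y a e : entry k y a e -> [/\ y < k, a < k & e < k].
Proof.
move=> [/bit_lt lt_k _].
by have le_p := cpair_ge y (cpair a e); have le_q := cpair_ge a e; split; lia.
Qed.

Lemma defined_by_fun k y m x k' y' :
  defined_by k y m x -> defined_by k' y' m x -> k = k' /\ y = y'.
Proof.
move=> [e [a [-> ma am [ea ua]]]] [e' [a' [/gen_inj[<- <-] ma' am' [ea' _]]]].
split=> //; apply/(ua _ _ _ ea'); split=> //; apply: eq_bit => j; apply/idP/idP.
  by move=> /am/ma'[i [ia /gen_inj[_ ->]]].
by move=> /am'/ma[i [ia /gen_inj[_ ->]]].
Qed.

Lemma defined_by_inj k y m x m' x' :
  defined_by k y m x -> defined_by k y m' x' -> m = m' /\ x = x'.
Proof.
move=> [e [a [-> ma am [ea ua]]]] [e' [a' [-> ma' am' [ea' _]]]].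
have [aa <-] := (ua _ _ _ ea').1 erefl; split=> //.
by subst a'; apply: eq_bit => u; apply/idP/idP => [/ma|/ma'] [j [ja ->]]; auto.
Qed.

Lemma code_graph_total m x : exists z, code_graph m x z.
Proof.
have [[k [y d]]|nd] := pselect (exists k y, defined_by k y m x).
  by exists (gen k y); left; exists k, y.
by exists (form m x); right.
Qed.

Lemma code_graph_fun m x z z' : code_graph m x z -> code_graph m x z' -> z = z'.
Proof.
move=> [[k [y [d ->]]]|[nd ->]] [[k' [y' [d' ->]]]|[nd' ->]] //.
- by have [-> ->] := defined_by_fun d d'.
- by case: nd'; exists k, y.
- by case: nd; exists k', y'.
Qed.

Lemma code_graph_inj m x m' x' z :
  code_graph m x z -> code_graph m' x' z -> m = m' /\ x = x'.
Proof.
move=> [[k [y [d ->]]]|[nd ->]] [[k' [y' [d' E]]]|[nd' E]].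
- by have [kk yy] := gen_inj E; subst; exact: defined_by_inj d d'.
- by case: (gen_form E).
- by case: (gen_form (esym E)).
- exact: form_inj E.
Qed.

Definition web_code_val (p : {fset nat} * nat) : nat :=
  sval (cid (code_graph_total (code p.1) p.2)).

Lemma web_code_graph a x z : code_graph (code a) x z <-> z = web_code_val (a, x).
Proof.
rewrite /web_code_val /=; case: cid => z' z'P; split=> [zP|->//].
exact: code_graph_fun zP z'P.
Qed.

Lemma web_code_val_inj : injective web_code_val.
Proof.
move=> [a x] [b y] E.
have ga := (web_code_graph a x _).2 erefl; have gb := (web_code_graph b y _).2 erefl.
rewrite -E in gb; have [ab xy] := code_graph_inj ga gb.
by rewrite -[a]codeK -[b]codeK ab xy.
Qed.

Definition free_web : total_pair := TotalPair infinite_nat web_code_val_inj.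

(** * Arithmetical description of the model *)

Lemma computable_cpair k A B : computable k A -> computable k B ->
  computable k (fun e => cpair (A e) (B e)).
Proof.
move=> AP BP; apply: computable_add => //.
by apply/computable_bin2/computableS/computable_add.
Qed.

Lemma computable_double k A : computable k A -> computable k (fun e => (A e).*2).
Proof.
move=> AP; under eq_fun do rewrite -mul2n.
by apply: computable_mul => //; exact: computable_const.
Qed.

Lemma computable_gen k A B : computable k A -> computable k B ->
  computable k (fun e => gen (A e) (B e)).
Proof. by move=> AP BP; apply/computable_double/computable_cpair. Qed.

Lemma computable_form k A B : computable k A -> computable k B ->
  computable k (fun e => form (A e) (B e)).
Proof. by move=> AP BP; apply/computableS/computable_double/computable_cpair. Qed.

Ltac computability := repeat first
  [ exact: computable_var | assumption | exact: computable_const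
  | apply: computable_gen | apply: computable_form | apply: computable_cpair
  | apply: computable_add | apply: computable_mul | apply: computable_exp2
  | apply: computableS | apply: computable_double ].

Lemma decidable_in_bit k A B : computable k A -> computable k B ->
  decidable_in k (fun e => bit (A e) (B e)).
Proof.
apply: (@decidable_in_comp2 _ bit).
apply: (@decidable_in_ext _ (fun e => exists s r,
    e 1 = (s.*2 + 1) * 2 ^ e 0 + r /\ r.+1 <= 2 ^ e 0)) => [e|].
  rewrite /bit; split=> [[s [r [-> rlt]]]|].
    by rewrite divnMDl ?expn_gt0 // divn_small // addn0 oddD odd_double.
  set q := e 1 %/ 2 ^ e 0 => qodd; exists q./2, (e 1 %% 2 ^ e 0).
  rewrite ltn_pmod ?expn_gt0 //; split=> //.
  rewrite {1}(divn_eq (e 1) (2 ^ e 0)) -/q; congr (_ * _ + _).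
  by rewrite -{1}(odd_double_half q) qodd addnC.
apply: (decidable_in_exists (B := fun e => e 1)); first computability.
  move=> e s [r [-> _]]; rewrite -{1}[s]muln1.
  apply: leq_trans (leq_addr _ _); apply: leq_mul; last by rewrite expn_gt0.
  by rewrite -addnn; lia.
apply: (decidable_in_exists (B := fun e => e 2)); first computability.
  by move=> e r [-> _]; exact: leq_addl.
apply: decidable_in_and.
  by apply: decidable_in_eq; computability.
by apply: decidable_in_le; computability.
Qed.

Ltac decidability := repeat first
  [ progress computability
  | apply: decidable_in_bit | apply: decidable_in_eq | apply: decidable_in_le
  | apply: decidable_in_and | apply: decidable_in_or | apply: decidable_in_not
  | apply: decidable_in_iff | apply: decidable_in_impl ].

Lemma decidable_in_subbits k A B : computable k A -> computable k B ->
  decidable_in k (fun e => forall u, bit u (A e) -> bit u (B e)).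
Proof.
apply: (@decidable_in_comp2 _ (fun a b => forall u, bit u a -> bit u b)).
apply: (decidable_in_forall (B := fun e => e 0)); decidability.
by move=> e j /not_implyP[/bit_lt/ltnW].
Qed.

Lemma decidable_in_entry k A B C D :
  computable k A -> computable k B -> computable k C -> computable k D ->
  decidable_in k (fun e => entry (A e) (B e) (C e) (D e)).
Proof.
apply: (@decidable_in_comp4 _ entry); apply: decidable_in_and; first decidability.
have bound n y a b : bit (cpair y (cpair a b)) n -> [/\ y <= n, a <= n & b <= n].
  by move=> /bit_lt; have := cpair_ge y (cpair a b); have := cpair_ge a b; split; lia.
apply: (decidable_in_forall (B := fun e => e 0)); first computability.
  by move=> e y /existsNP[a /existsNP[b /not_implyP[/bound[]]]].
apply: (decidable_in_forall (B := fun e => e 1)); first computability.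
  by move=> e a /existsNP[b /not_implyP[/bound[]]].
apply: (decidable_in_forall (B := fun e => e 2)); first computability.
  by move=> e b /not_implyP[/bound[]].
decidability.
Qed.

Lemma defined_by_le k y m x : defined_by k y m x -> k <= x /\ y <= x.
Proof.
move=> [e [a [-> _ _ /entry_lt[yk _ _]]]].
by have := gen_ge k e; lia.
Qed.

Lemma decidable_in_defined_by k A B C D :
  computable k A -> computable k B -> computable k C -> computable k D ->
  decidable_in k (fun e => defined_by (A e) (B e) (C e) (D e)).
Proof.
apply: (@decidable_in_comp4 _ defined_by).
apply: (decidable_in_exists (B := fun e => e 0)); first computability.
  by move=> e j [a [_ _ _ /entry_lt[_ _ /ltnW]]].
apply: (decidable_in_exists (B := fun e => e 1)); first computability.
  by move=> e j [_ _ _ /entry_lt[_ /ltnW]].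
apply: (@decidable_in_ext _ (fun e =>
   ((e 5 = gen (e 2) (e 1)) /\
    (forall u, bit u (e 4) -> exists j, bit j (e 0) /\ u = gen (e 2) j)) /\
    ((forall j, bit j (e 0) -> bit (gen (e 2) j) (e 4)) /\
     entry (e 2) (e 3) (e 0) (e 1)))) => [e|]; first by split=> [[[]]? ? []|[]].
apply: decidable_in_and; apply: decidable_in_and; first decidability.
- apply: (decidable_in_forall (B := fun e => e 4)); first computability.
    by move=> e u /not_implyP[/bit_lt/ltnW].
  apply: decidable_in_impl; first decidability.
  apply: (decidable_in_exists (B := fun e => e 1)); first computability.
    by move=> e j [/bit_lt/ltnW].
  decidability.
- apply: (decidable_in_forall (B := fun e => e 0)); first computability.
    by move=> e u /not_implyP[/bit_lt/ltnW].
  decidability.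
- by apply: decidable_in_entry; computability.
Qed.

Lemma decidable_in_code_graph k A B C :
  computable k A -> computable k B -> computable k C ->
  decidable_in k (fun e => code_graph (A e) (B e) (C e)).
Proof.
apply: (@decidable_in_comp3 _ code_graph).
apply: decidable_in_or.
  apply: (decidable_in_exists (B := fun e => e 1)); first computability.
    by move=> e j [y [/defined_by_le[]]].
  apply: (decidable_in_exists (B := fun e => e 2)); first computability.
    by move=> e y [/defined_by_le[]].
  apply: decidable_in_and; last decidability.
  by apply: decidable_in_defined_by; computability.
apply: decidable_in_and; last decidability.
apply: decidable_in_not.
apply: (decidable_in_exists (B := fun e => e 1)); first computability.
  by move=> e j [y /defined_by_le[]].
apply: (decidable_in_exists (B := fun e => e 2)); first computability.
  by move=> e y /defined_by_le[].
by apply: decidable_in_defined_by; computability.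
Qed.

Definition decode_bound z := 2 ^ (gen z z).+1.

Lemma code_graph_bound m x z :
  code_graph m x z -> m <= decode_bound z /\ x <= decode_bound z.
Proof.
have small n : n <= gen z z -> n <= decode_bound z.
  by move=> le_n; apply: leq_trans (ltnW (ltn_expl _ (ltnSn 1))); exact: leqW.
have leq_gen k y j : j <= k -> gen k j <= gen (gen k y) (gen k y).
  move=> jk; rewrite /gen leq_double; apply: leq_cpair; have := cpair_ge k y; lia.
move=> [[k [y [[e [a [-> ma am /entry_lt[yk ak ek]]]] zE]]]|[_ zE]].
  split; last by apply: small; rewrite zE leq_gen // ltnW.
  apply/ltnW/ltn_exp2_bit => u /ma[j [/bit_lt ja ->]].
  by rewrite ltnS zE leq_gen //; lia.
have := form_gt m x; have := gen_ge z z.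
by split; apply: small; lia.
Qed.

Lemma computable_decode_bound k A : computable k A ->
  computable k (fun e => decode_bound (A e)).
Proof. by move=> AP; apply/computable_exp2/computableS/computable_gen. Qed.

Lemma decidable_in_join k A B C : computable k A -> computable k B -> computable k C ->
  decidable_in k (fun e => forall u, bit u (B e) <-> bit u (A e) \/ bit u (C e)).
Proof.
apply: (@decidable_in_comp3 _ (fun a b c => forall u, bit u b <-> bit u a \/ bit u c)).
apply: (decidable_in_forall (B := fun e => e 0 + e 1 + e 2)); decidability.
move=> e j nP.
have [/bit_lt|] := boolP (bit j (e 0)); first lia.
have [/bit_lt|] := boolP (bit j (e 1)); first lia.
have [/bit_lt|] := boolP (bit j (e 2)); first lia.
by move=> /negP n2 /negP n1 /negP n0; case: nP; split=> // -[].
Qed.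

Definition ap_code a b x :=
  exists c, (forall u, bit u c -> bit u b) /\ exists z, code_graph c x z /\ bit z a.

Lemma decidable_in_ap_code k A B C :
  computable k A -> computable k B -> computable k C ->
  decidable_in k (fun e => ap_code (A e) (B e) (C e)).
Proof.
apply: (@decidable_in_comp3 _ ap_code).
apply: (decidable_in_exists (B := fun e => e 1)); first computability.
  by move=> e c [/leq_bit].
apply: decidable_in_and; first by apply: decidable_in_subbits; computability.
apply: (decidable_in_exists (B := fun e => e 1)); first computability.
  by move=> e z [_ /bit_lt/ltnW].
by apply: decidable_in_and; [apply: decidable_in_code_graph; computability|decidability].
Qed.

Definition step_code f m x := exists p q,
  [/\ bit (cpair p q) f, forall u, bit u p -> bit u m & bit x q].

Lemma decidable_in_step_code k A B C :
  computable k A -> computable k B -> computable k C ->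
  decidable_in k (fun e => step_code (A e) (B e) (C e)).
Proof.
apply: (@decidable_in_comp3 _ step_code).
have bound n p q : bit (cpair p q) n -> p <= n /\ q <= n.
  by move=> /bit_lt; have := cpair_ge p q; lia.
apply: (decidable_in_exists (B := fun e => e 0)); first computability.
  by move=> e p [q [/bound[]]].
apply: (decidable_in_exists (B := fun e => e 1)); first computability.
  by move=> e q [/bound[]].
apply: (@decidable_in_ext _ (fun e => bit (cpair (e 1) (e 0)) (e 2) /\
  (forall u, bit u (e 1) -> bit u (e 3)) /\ bit (e 4) (e 0))) => [e|].
  by split=> [[? []]|[]].
apply: decidable_in_and; first decidability.
by apply: decidable_in_and; [apply: decidable_in_subbits; computability|decidability].
Qed.

Lemma decidable_in_lam_code k (P : nat -> nat -> (nat -> nat) -> Prop) A :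
  computable k A ->
  decidable_in k.+3 (fun e => P (e 1) (e 0) (fun i => e i.+3)) ->
  decidable_in k (fun e => forall z, bit z (A e) ->
    exists m x, code_graph m x z /\ P m x e).
Proof.
move=> AP PP.
apply: (decidable_in_forall (B := A)) => //.
  by move=> e z /not_implyP[/bit_lt/ltnW].
apply: decidable_in_impl.
  by apply: decidable_in_bit; [computability|exact: computable_shift].
apply: (decidable_in_exists (B := fun e => decode_bound (e 0))).
- by apply: computable_decode_bound; computability.
- by move=> e m [x [/code_graph_bound[]]].
apply: (decidable_in_exists (B := fun e => decode_bound (e 1))).
- by apply: computable_decode_bound; computability.
- by move=> e m [/code_graph_bound[]].
by apply: decidable_in_and; first by apply: decidable_in_code_graph; computability.
Qed.

(** * Effectivity *)

Import Order.TTheory.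
Local Open Scope classical_set_scope.
Local Open Scope order_scope.

Definition complete d (E : porderType d) := forall A : set E, supremums A !=set0.

Lemma complete_powerset T : complete (set T).
Proof. by move=> A; exists (\bigcup_(X in A) X); exact: supremums_bigcup. Qed.

Lemma le_subset T (X Y : set T) : X <= Y <-> X `<=` Y.
Proof. by rewrite subsetEset. Qed.

Section CompleteCodomain.
Context d d' (D : cpoType d) (E : cpoType d').
Hypothesis cE : complete E.

Lemma complete_scott : complete {scott D -> E}.
Proof.
move=> A; have [s sP] := choice (fun x => cE (eval_at A x)).
by exists (ScottFun (scott_lub_continuous sP)); exact: scott_pointwise_lub.
Qed.

Lemma supremum_complete (A : set E) : supremums A (supremum \bot A).
Proof.
rewrite /supremum; case: ifPn => [/eqP ->|_].
  by split=> [x []|u _]; exact: le0x.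
case: xgetP => [s _ //|nA]; have [s sA] := cE A.
by case: (nA s).
Qed.

Lemma complete_has_ubound (A : set E) : has_ubound A.
Proof. by have [s [uA _]] := cE A; exists s. Qed.

End CompleteCodomain.

Section FunNum.
Context d d' (D : cpoType d) (E : cpoType d').
Context (num : nat -> compacts D) (num' : nat -> compacts E).
Hypothesis cE : complete E.

Lemma fun_num_supremum n :
  supremums (steps num num' (pair_set n)) (compact_val (fun_num num num' n)).
Proof.
rewrite /= /fun_num_val; case: pselect => [c|nc].
  exact: (supremum_complete (complete_scott cE)).
by exfalso; apply: nc => J _ _; exact: (complete_has_ubound cE).
Qed.

Lemma fun_num_le n (f : {scott D -> E}) :
  (compact_val (fun_num num num' n)) <= f <->
  forall p, pair_set n p -> (num' p.2 : E) <= f (num p.1 : D).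
Proof.
have [ub lub] := fun_num_supremum n; split=> [nf p pn|H].
  have /scott_leP/(_ (num p.1 : D)) := le_trans (ub _ (ex_intro2 _ _ p pn erefl)) nf.
  by rewrite /= /step_val lexx.
apply: lub => _ [p pn <-]; apply/scott_leP => x /=; rewrite /step_val.
case: ifP => [px|_]; last exact: le0x.
by apply: le_trans (H p pn) _; exact: scott_mono (scott_valP f) _ _ px.
Qed.

End FunNum.

Lemma fun_num_powerset d (D : cpoType d) T (num : nat -> compacts D)
    (num' : nat -> compacts (set T)) n X x :
  (compact_val (fun_num num num' n) : {scott D -> set T}) X x <->
  exists p, [/\ pair_set n p, (num p.1 : D) <= X & compact_val (num' p.2) x].
Proof.
set f : {scott D -> set T} := compact_val (fun_num num num' n).
have sE Y : supremums (eval_at (steps num num' (pair_set n)) Y)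
    (\bigcup_(Z in eval_at (steps num num' (pair_set n)) Y) Z).
  exact: supremums_bigcup.
have -> : f = ScottFun (scott_lub_continuous sE).
  apply: is_subset1_supremums (fun_num_supremum _ _ (@complete_powerset T) _) _.
  exact: scott_pointwise_lub.
split=> [[_ [_ [p pn <-] <-]]|[p [pn pX px]]] /=.
  by rewrite /step_val; case: ifP => // pX px; exists p.
exists (step_val (num p.1) (compact_val (num' p.2)) X).
  by exists (step (num p.1) (compact_val (num' p.2))) => //; exists p.
by rewrite /step_val pX.
Qed.

Section Powerset.
Context (G : total_pair).

Lemma fset_compact (a : {fset G}) : compact_elt ([set` a] : set G).
Proof.
move=> A l dA /is_subset1_supremums/(_ (supremums_bigcup A)) ->.
by move=> /le_subset/(fset_in_directed dA)[X AX aX]; exists X => //; exact/le_subset.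
Qed.

Definition fsets_below (X : set G) : set (set G) :=
  [set [set` a] | a in [set a : {fset G} | [set` a] `<=` X]].

Lemma directed_fsets_below X : directed (fsets_below X).
Proof.
split; first by exists [set` fset0], fset0.
move=> _ _ [a aX <-] [b bX <-]; exists [set` (a `|` b)%fset].
split; try apply/le_subset.
- by exists (a `|` b)%fset => // t; rewrite /= in_fsetU => /orP[/aX|/bX].
- by move=> t /=; rewrite in_fsetU => ->.
- by move=> t /=; rewrite in_fsetU => ->; rewrite orbT.
Qed.

Lemma supremums_fsets_below X : supremums (fsets_below X) X.
Proof.
split=> [_ [a aX <-]|U UX]; apply/le_subset => // z Xz.
suff /UX/le_subset : fsets_below X [set` [fset z]%fset].
  by apply; rewrite /= inE.
by exists [fset z]%fset => // t; rewrite /= inE => /eqP ->.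
Qed.

Lemma compact_powerset (X : set G) :
  compact_elt X <-> exists a : {fset G}, X = [set` a].
Proof.
split=> [cX|[a ->]]; last exact: fset_compact.
have [_ [a aX <-]] := cX _ _ (directed_fsets_below X) (supremums_fsets_below X) (lexx _).
by move=> /le_subset Xa; exists a; apply/seteqP.
Qed.

Lemma compacts_below (X : set G) :
  [set k | compact_elt k /\ k <= X] = fsets_below X.
Proof.
apply/seteqP; split=> [k [/compact_powerset[a ->] /le_subset aX]|_ [a aX <-]].
  by exists a.
by split; [exact: fset_compact|exact/le_subset].
Qed.

Lemma ap_fset (a : {fset G}) (Y : set G) :
  exists b : {fset G}, gm_ap_val [set` a] Y = [set` b].
Proof.
suff /finite_fsetP : finite_set (gm_ap_val [set` a] Y) by [].
have fin : finite_set [set p : {fset G} * G | web_code p \in a].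
  apply: (@finite_preimage _ _ [set` a]); last exact: finite_fset.
  by move=> p q _ _; exact: web_code_inj.
apply: sub_finite_set (finite_image snd fin).
by move=> x [c _ ca]; exists (c, x).
Qed.

End Powerset.

Section Effectivity.
Local Notation G := free_web.

Definition bits_compact n : compacts (graph_model G) :=
  Compact (@fset_compact G (bits n)).

Lemma bits_le n (Y : set nat) :
  (bits_compact n : graph_model G) <= Y <-> forall u, bit u n -> Y u.
Proof.
split=> [/le_subset H u un|H]; first by apply: H; rewrite /= in_bits.
by apply/le_subset => u; rewrite /= in_bits => /H.
Qed.

Lemma bits_compact_surj (k : graph_model G) :
  compact_elt k -> exists n, k = bits_compact n.
Proof.
by move=> /compact_powerset[a ->]; exists (code a); rewrite /= codeK.
Qed.

Lemma scott_domain_free : scott_domain (graph_model G).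
Proof.
split=> [A _|]; first exact: complete_powerset.
split=> [|X].
  apply: (@sub_countable _ _ _ (range (fun n => bits_compact n : graph_model G))).
    by apply: subset_card_le => k /bits_compact_surj[n ->]; exists n.
  exact: card_image_le.
cbv zeta; rewrite (_ : [set k | _] = fsets_below X); last exact: compacts_below.
by split; [exact: directed_fsets_below|exact: supremums_fsets_below].
Qed.

Lemma bits_ap a b x : gm_ap G [set` bits a] [set` bits b] x <-> ap_code a b x.
Proof.
split=> [[c cb ca]|[c [cb [z [zc za]]]]].
  exists (code c); split=> [u|]; first by rewrite bit_code => /cb; rewrite /= in_bits.
  exists (web_code (c, x)); split; first exact/web_code_graph.
  by rewrite -in_bits.
exists (bits c) => [u|]; first by rewrite /= !in_bits => /cb.
rewrite /= in_bits; move: zc; rewrite -{1}(bitsK c).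
by move=> /web_code_graph <-.
Qed.

Lemma bits_lam (f : {scott set G -> set G}) z :
  gm_lam G f z <-> exists m x, code_graph m x z /\ f [set` bits m] x.
Proof.
split=> [[a [x [fx ->]]]|[m [x [g fx]]]].
  by exists (code a), x; rewrite codeK; split=> //; exact/web_code_graph.
exists (bits m), x; split=> //.
by apply/web_code_graph; rewrite bitsK.
Qed.

Local Notation num := bits_compact.

Lemma bits_fun_num f m x :
  ((compact_val (fun_num num num f) : {scott graph_model G -> graph_model G})
    (num m : graph_model G) : set nat) x <-> step_code f m x.
Proof.
split=> [/fun_num_powerset[[p q] [pf /bits_le pm qx]]|[p [q [pf pm qx]]]].
  exists p, q; split=> //; first by move=> u /pm; rewrite /= in_bits.
  by move: qx; rewrite /= in_bits.
apply/fun_num_powerset; exists (p, q); split=> //=; last by rewrite in_bits.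
by apply/bits_le => u /pm; rewrite /= in_bits.
Qed.

Lemma re_ap : re_elt (fun_num num (fun_num num num)) (lm_ap (graph_model G)).
Proof.
apply: rec_enumerable_decidable.
apply: (@decidable_in_ext _ (fun e => forall p1 p2, bit (cpair p1 p2) (e 0%N) ->
  forall q1 q2, bit (cpair q1 q2) p2 -> forall x, bit x q2 -> ap_code p1 q1 x)) => [e|].
  have cG : complete (graph_model G) := @complete_powerset nat.
  split=> [H|/(fun_num_le _ _ (complete_scott cG)) H p1 p2 pn q1 q2 qp x xq].
    apply/(fun_num_le _ _ (complete_scott cG)) => -[p1 p2] /H Hp.
    apply/(fun_num_le _ _ cG) => -[q1 q2] /Hp Hq.
    by apply/bits_le => x /Hq /bits_ap.
  have /(fun_num_le _ _ cG)/(_ (q1, q2) qp)/bits_le/(_ _ xq) := H (p1, p2) pn.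
  exact: (bits_ap _ _ _).1.
have bound p q n : bit (cpair p q) n -> (p <= n /\ q <= n)%N.
  by move=> /bit_lt; have := cpair_ge p q; lia.
apply: (decidable_in_forall (B := fun e => e 0%N)); first computability.
  by move=> e p /existsNP[q /not_implyP[/bound[]]].
apply: (decidable_in_forall (B := fun e => e 1%N)); first computability.
  by move=> e q /not_implyP[/bound[]].
apply: decidable_in_impl; first decidability.
apply: (decidable_in_forall (B := fun e => e 0%N)); first computability.
  by move=> e p /existsNP[q /not_implyP[/bound[]]].
apply: (decidable_in_forall (B := fun e => e 1%N)); first computability.
  by move=> e q /not_implyP[/bound[]].
apply: decidable_in_impl; first decidability.
apply: (decidable_in_forall (B := fun e => e 0%N)); first computability.
  by move=> e x /not_implyP[/bit_lt/ltnW].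
apply: decidable_in_impl; first decidability.
by apply: decidable_in_ap_code; computability.
Qed.

Lemma re_lam : re_elt (fun_num (fun_num num num) num) (lm_lam (graph_model G)).
Proof.
apply: rec_enumerable_decidable.
apply: (@decidable_in_ext _ (fun e => forall p1 p2, bit (cpair p1 p2) (e 0%N) ->
  forall z, bit z p2 -> exists m x, code_graph m x z /\ step_code p1 m x)) => [e|].
  have cG : complete (graph_model G) := @complete_powerset nat.
  split=> [H|/(fun_num_le _ _ cG) H p1 p2 pn].
    apply/(fun_num_le _ _ cG) => -[p1 p2] /H Hp.
    apply/bits_le => z /Hp [m [x [g s]]]; apply/bits_lam.
    by exists m, x; split=> //; exact/bits_fun_num.
  have /bits_le H1 := H (p1, p2) pn.
  move=> z /H1/bits_lam[m [x [g s]]]; exists m, x; split=> //.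
  exact/bits_fun_num.
have bound p q n : bit (cpair p q) n -> (p <= n /\ q <= n)%N.
  by move=> /bit_lt; have := cpair_ge p q; lia.
apply: (decidable_in_forall (B := fun e => e 0%N)); first computability.
  by move=> e p /existsNP[q /not_implyP[/bound[]]].
apply: (decidable_in_forall (B := fun e => e 1%N)); first computability.
  by move=> e q /not_implyP[/bound[]].
apply: decidable_in_impl; first decidability.
apply: (@decidable_in_lam_code 3 (fun m x e => step_code (e 1%N) m x)); first computability.
by apply: decidable_in_step_code; computability.
Qed.

Lemma bits_effective_domain : effective_domain num.
Proof.
split.
- exact: scott_domain_free.
- exact: bits_compact_surj.
- apply: (@rec_decidable2 (fun m n =>
    has_ubound [set (num m : graph_model G); (num n : graph_model G)])).
  apply: (@decidable_in_ext _ (fun=> True)) => [e|]; last exact: computable_const.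
  by split=> // _; exact/complete_has_ubound/complete_powerset.
- apply: (@rec_decidable3 (fun m n k => supremums
    [set (num m : graph_model G); (num k : graph_model G)] (num n : graph_model G))).
  apply: (@decidable_in_ext _ (fun e =>
    forall u, bit u (e 1%N) <-> bit u (e 0%N) \/ bit u (e 2%N))).
    move=> e; split=> [H|[ub lub] u].
      split=> [_ [->|->]|U UU]; apply/bits_le => u; rewrite /= ?in_bits.
      + by move=> b0; apply/H; left.
      + by move=> b2; apply/H; right.
      + move=> /H[b0|b2].
          by have /bits_le := UU _ (or_introl erefl); apply.
        by have /bits_le := UU _ (or_intror erefl); apply.
    split=> [b1|[b0|b2]].
    + have /bits_le : (num (e 1%N) : graph_model G) <=
          ([set v | bit v (e 0%N) \/ bit v (e 2%N)] : set nat).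
        by apply: lub => _ [->|->]; apply/bits_le => v /=; [left|right].
      by apply.
    + by have /bits_le/(_ _ b0) := ub _ (or_introl erefl); rewrite /= in_bits.
    + by have /bits_le/(_ _ b2) := ub _ (or_intror erefl); rewrite /= in_bits.
  by apply: decidable_in_join; computability.
Qed.

Lemma compact_dec_elt n : dec_elt num (num n : graph_model G).
Proof.
apply: (@rec_decidable1 (fun m => (num m : graph_model G) <= (num n : graph_model G))).
apply: (@decidable_in_ext _ (fun e => forall u, bit u (e 0%N) -> bit u n)) => [e|].
  by split=> [H|/bits_le H u /H]; [apply/bits_le => u /H|]; rewrite /= in_bits.
by apply: decidable_in_subbits; computability.
Qed.

Lemma effective_free : effective (graph_model G).
Proof.
exists num; split.
- by split; [exact: bits_effective_domain|exact: re_ap|exact: re_lam].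
- move=> k es _; suff [n ->] : exists n, apps k es = num n by exact: compact_dec_elt.
  case: k => k /=; elim: es k => [|X es IH] Y cY; first exact: bits_compact_surj.
  apply: IH => /=; have [a ->] := (@compact_powerset G _).1 cY.
  by have [b /= ->] := ap_fset a X; exact: (@fset_compact G b).
- move=> f _ /rec_decidable2_inv fP.
  apply: (@rec_decidable1 (fun n => (num n : graph_model G) <= lm_lam (graph_model G) f)).
  apply: (@decidable_in_ext _ (fun e => forall z, bit z (e 0%N) -> exists m x,
     code_graph m x z /\ (num (2 ^ x) : graph_model G) <= f (num m : graph_model G))).
    move=> e; have E m x : (num (2 ^ x) : graph_model G) <= f (num m : graph_model G) <->
         (f [set` bits m] : set nat) x.
      split=> [/bits_le/(_ x)|fx]; first by apply; rewrite bit_exp2.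
      by apply/bits_le => u; rewrite bit_exp2 => /eqP ->.
    split=> [H|/bits_le H z zn].
      apply/bits_le => z /H[m [x [g /E fx]]]; apply/bits_lam.
      by exists m, x.
    have /bits_lam[m [x [g fx]]] := H z zn.
    by exists m, x; split=> //; exact/E.
  apply: (@decidable_in_lam_code 1
    (fun m x _ => (num (2 ^ x) : graph_model G) <= f (num m : graph_model G))).
    computability.
  apply: (@decidable_in_comp2 _ (fun n m =>
    (num m : graph_model G) <= f (num n : graph_model G)) (fun e => e 1%N) (fun e => 2 ^ e 0)%N fP).
    computability.
  computability.
Qed.

End Effectivity.

(** * Minimality *)

Section Minimality.
Local Open Scope fset_scope.

(* [A] and [T] contain the atoms and the values of [web_code] occurring in some finite derivation
   of [x \in interp M rho]: every map respecting these carries the derivation over. *)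
Definition supports (G' : total_pair) M (rho : nat -> set G') (x : G')
    (A : set G') (T : set ({fset G'} * G')) :=
  forall (H : total_pair) (phi : G' -> H) (sigma : nat -> set H),
    (forall p, T p -> phi (web_code p) = web_code ([fset phi z | z in p.1], phi p.2)) ->
    (forall v z, A z -> rho v z -> sigma v (phi z)) ->
    (interp (graph_model H) M sigma : set H) (phi x).

Lemma interp_finite_support (G' : total_pair) M (rho : nat -> set G') (x : G') :
  (interp (graph_model G') M rho : set G') x ->
  exists A T, [/\ finite_set A, finite_set T & supports M rho x A T].
Proof.
elim: M rho x => [v|P IHP Q IHQ|v P IHP] rho x.
- move=> rx; exists [set x]%classic, set0; split; [exact: finite_set1|exact: finite_set0|].
  by move=> H phi sigma _; apply.
- move=> [a aQ /IHP[A [T [finA finT AT]]]].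
  have /choice[AT' AT'P] : forall z, exists AT' : set G' * set ({fset G'} * G'), z \in a ->
      [/\ finite_set AT'.1, finite_set AT'.2 & supports Q rho z AT'.1 AT'.2].
    move=> z; case: (boolP (z \in a)) => [/aQ/IHQ[B [U BU]]|_]; first by exists (B, U).
    by exists (set0, set0).
  exists (A `|` \bigcup_(z in [set` a]) (AT' z).1)%classic.
  exists ([set (a, x)] `|` T `|` \bigcup_(z in [set` a]) (AT' z).2)%classic; split.
  + rewrite finite_setU; split=> //.
    by apply: bigcup_finite => [|z /AT'P[]//]; exact: finite_fset.
  + rewrite !finite_setU; split; first by split=> //; exact: finite_set1.
    by apply: bigcup_finite => [|z /AT'P[]//]; exact: finite_fset.
  move=> H phi sigma phiT phiA.
  exists [fset phi z | z in a].
    move=> _ /= /imfsetP[z /= za ->]; have [_ _] := AT'P z za; apply.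
      by move=> p pT; apply: phiT; right; exists z.
    by move=> v w wA; apply: phiA; right; exists z.
  rewrite -(phiT (a, x)); last by left; left.
  apply: AT; first by move=> p pT; apply: phiT; left; right.
  by move=> v w wA; apply: phiA; left.
- move=> [a [y [/IHP[A [T [finA finT AT]]] ->]]].
  exists A, ([set (a, y)] `|` T)%classic; split=> //.
    by rewrite finite_setU; split=> //; exact: finite_set1.
  move=> H phi sigma phiT phiA.
  exists [fset phi z | z in a], (phi y); split; last by rewrite phiT //; left.
  apply: AT; first by move=> p pT; apply: phiT; right.
  move=> w z zA; rewrite /env_set; case: ifP => // _; last exact: phiA.
  by move=> za; rewrite /=; apply: in_imfset.
Qed.

Definition pimage (T U : choiceType) (psi : T -> option U) (a : {fset T}) : {fset U} :=
  [fset y in pmap psi a].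

Lemma pimageP (T U : choiceType) (psi : T -> option U) a y :
  reflect (exists2 x, x \in a & psi x = Some y) (y \in pimage psi a).
Proof.
rewrite !inE /= mem_pmap; by apply: (iffP mapP) => -[x xa E]; exists x.
Qed.

Lemma interp_pull (G H : total_pair) (psi : H -> option G) :
  (forall a x, psi (web_code (a, x)) =
               omap (fun y => web_code (pimage psi a, y)) (psi x)) ->
  forall N (sigma : nat -> set H) (rho : nat -> set G) x y,
  (forall v z w, sigma v z -> psi z = Some w -> rho v w) ->
  (interp (graph_model H) N sigma : set H) x -> psi x = Some y ->
  (interp (graph_model G) N rho : set G) y.
Proof.
move=> psiE; elim=> [v|P IHP Q IHQ|v P IHP] sigma rho x y sr.
- exact: sr.
- move=> [a aQ xP] xy; exists (pimage psi a).
    by move=> w /= /pimageP[z za zw]; apply: IHQ zw; [exact: sr|exact: aQ].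
  by apply: IHP xP _; [exact: sr|rewrite psiE xy].
- move=> [a [z [zP ->]]]; rewrite psiE; case zw: (psi z) => [w|//] [<-].
  exists (pimage psi a), w; split=> //; apply: IHP zP zw => u t s.
  rewrite /env_set; case: ifP => _; last exact: sr.
  by move=> ta ts; apply/pimageP; exists t.
Qed.

Lemma ltn_rec T (t0 : T) (F : (nat -> T) -> nat -> T) :
  (forall g h z, (forall y, (y < z)%N -> g y = h y) -> F g z = F h z) ->
  exists f, forall z, f z = F f z.
Proof.
move=> Fext; pose g n := iter n F (fun=> t0).
have gE z n m : (z < n -> z < m -> g n z = g m z)%N.
  elim/ltn_ind: z n m => z IH [//|n] [//|m] zn zm; apply: Fext => y yz.
  by apply: IH => //; apply: leq_trans yz _.
by exists (fun z => g z.+1 z) => z; apply: Fext => y yz; exact: gE.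
Qed.

Lemma unpair_exists : exists u : nat -> nat * nat,
  (forall m n, u (cpair m n) = (m, n)) /\ forall z, ((u z).1 + (u z).2 <= z)%N.
Proof.
have /choice[u uP] : forall z, exists p : nat * nat,
    (forall m n, z = cpair m n -> p = (m, n)) /\ (p.1 + p.2 <= z)%N.
  move=> z; have [[m [n ->]]|nz] := pselect (exists m n, z = cpair m n).
    by exists (m, n); split=> [m' n' /cpair_inj[-> ->]//|]; exact: cpair_ge.
  by exists (0%N, 0%N); split=> // m n zE; case: nz; exists m, n.
by exists u; split=> [m n|z]; [apply: (uP _).1|apply: (uP z).2].
Qed.

Section PartialMap.
Context (G' : total_pair) (k : nat) (s : seq G').

Lemma pull_exists : exists psi : nat -> option G',
  (forall k' e, psi (gen k' e) = if k' == k then onth s e else None) /\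
  (forall m x, psi (form m x) =
     omap (fun y => web_code (pimage psi (bits m), y)) (psi x)).
Proof.
have [u [uK u_le]] := unpair_exists.
pose F (g : nat -> option G') z :=
  if odd z then
    omap (fun y => web_code (pimage g (bits (u z./2).1), y)) (g (u z./2).2)
  else if (u z./2).1 == k then onth s (u z./2).2 else None.
have [|psi psiE] := @ltn_rec _ None F.
  move=> g h z gh; rewrite /F; case: ifP => // zodd.
  have := u_le z./2; set m := (u _).1; set x := (u _).2 => mx.
  have zE : z = (z./2).*2.+1 by rewrite -{1}(odd_double_half z) zodd.
  rewrite gh; last by lia.
  suff -> : pimage g (bits m) = pimage h (bits m) by [].
  have E w : w \in bits m -> g w = h w.
    by rewrite in_bits => /bit_lt wm; apply: gh; lia.
  by apply/fsetP => y; apply/pimageP/pimageP => -[w wm wy]; exists w => //;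
    rewrite -wy E.
exists psi; split=> [k' e|m x]; rewrite psiE /F.
  by rewrite /gen odd_double doubleK uK.
by rewrite /form /= odd_double /= uphalf_double uK.
Qed.

End PartialMap.

Section FinitePart.
Context (G' : total_pair) (T : set ({fset G'} * G')) (s : seq G').
Hypothesis finT : finite_set T.
Hypothesis Ts : forall p, T p ->
  [/\ {subset p.1 <= s}, p.2 \in s & web_code p \in s].

Local Notation idx := (index^~ s).

Let idx_inj x y : x \in s -> y \in s -> idx x = idx y -> x = y.
Proof. by move=> xs ys E; rewrite -(nth_index x xs) E nth_index. Qed.

Let row p := cpair (idx (web_code p)) (cpair (code [fset idx z | z in p.1]) (idx p.2)).

Lemma table_exists : exists k, forall y a e,
  bit (cpair y (cpair a e)) k <-> exists p,
   [/\ T p, y = idx (web_code p), a = code [fset idx z | z in p.1] & e = idx p.2].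
Proof.
have [K KE] := finite_fsetP.1 (finite_image row finT).
exists (code K) => y a e; rewrite bit_code.
have -> : (cpair y (cpair a e) \in K) = [set` K] (cpair y (cpair a e)) :> Prop by [].
rewrite -KE; split=> [[p Tp /cpair_inj[<- /cpair_inj[<- <-]]]|[p [Tp -> -> ->]]].
  by exists p.
by exists p.
Qed.

Lemma finite_part_retract : exists (phi : G' -> free_web) (psi : free_web -> option G'),
  [/\ forall p, T p -> phi (web_code p) = web_code ([fset phi z | z in p.1], phi p.2),
      forall a x, psi (web_code (a, x)) =
        omap (fun y => web_code (pimage psi a, y)) (psi x)
    & forall z, z \in s -> psi (phi z) = Some z].
Proof.
have [k kP] := table_exists.
have [psi [psi_gen psi_form]] := pull_exists k s.
have psiK z : z \in s -> psi (gen k (idx z)) = Some z.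
  by move=> zs; rewrite psi_gen eqxx (onthE s) (nth_map z) ?index_mem // nth_index.
exists (fun z => gen k (idx z)), psi; split=> //.
- move=> p Tp; apply/web_code_graph; left; exists k, (idx (web_code p)); split=> //.
  exists (idx p.2), (code [fset idx z | z in p.1]); split=> //.
  + move=> u; rewrite bit_code => /imfsetP[z /= zp ->].
    by exists (idx z); rewrite bit_code; split=> //; apply: in_imfset.
  + move=> j; rewrite bit_code => /imfsetP[z /= zp ->].
    by rewrite bit_code; apply/imfsetP; exists z.
  split; first by apply/kP; exists p.
  move=> y' a' e' /kP[q [Tq -> -> ->]].
  have [p1 p2 ps] := Ts Tp; have [q1 q2 qs] := Ts Tq.
  split=> [/(idx_inj ps qs)/web_code_inj ->//|[/(congr1 bits) + /(idx_inj p2 q2) pq2]].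
  rewrite !codeK => pq1; rewrite (surjective_pairing p) (surjective_pairing q) pq2.
  suff -> : p.1 = q.1 by [].
  apply/fsetP => z; apply/idP/idP => zp.
    have : idx z \in [fset idx z | z in p.1] by apply: in_imfset.
    by rewrite pq1 => /imfsetP[w /= wq /(idx_inj (p1 _ zp) (q1 _ wq)) ->].
  have : idx z \in [fset idx z | z in q.1] by apply: in_imfset.
  by rewrite -pq1 => /imfsetP[w /= wq /(idx_inj (q1 _ zp) (p1 _ wq)) ->].
- move=> a x; have : code_graph (code a) x (@web_code free_web (a, x)) by exact/web_code_graph.
  case=> [[k' [y [[e [b [-> ab ba [eb _]]]] ->]]]|[_ ->]]; last first.
    by rewrite psi_form codeK.
  rewrite !psi_gen; case: eqP => // kk; subst k'.
  have /kP[p [Tp -> bE ->]] := eb; have [p1 p2 ps] := Ts Tp.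
  have := psiK _ ps; have := psiK _ p2; rewrite !psi_gen !eqxx => -> -> /=.
  congr Some; rewrite [in LHS](surjective_pairing p); congr (web_code (_, _)).
  apply/fsetP => w; apply/idP/pimageP => [wp|[u]].
    exists (gen k (idx w)); last exact/psiK/p1.
    by rewrite -bit_code; apply: ba; rewrite bE bit_code; apply: in_imfset.
  rewrite -bit_code => /ab[j [+ ->]]; rewrite bE bit_code => /imfsetP[t /= tp ->].
  by rewrite psiK ?p1 // => -[<-].
Qed.

End FinitePart.

Lemma order_theory_minimum (G' : total_pair) :
  (order_theory (graph_model free_web) `<=` order_theory (graph_model G'))%classic.
Proof.
move=> [M N] /= MN rho; apply/le_subset => x /interp_finite_support.
move=> [A [T [finA finT AT]]].
pose S := (x |` A `|` \bigcup_(p in T) ([set` p.1] `|` [set p.2; web_code p]))%classic.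
have /finite_fsetP[s sE] : finite_set S.
  rewrite /S !finite_setU; split; first by split=> //; exact: finite_set1.
  apply: bigcup_finite => // p _; rewrite finite_setU; split; first exact: finite_fset.
  by rewrite finite_setU; split; exact: finite_set1.
have inS z : S z -> z \in enum_fset s by rewrite sE.
have [|phi [psi [phiT psiE psiK]]] := @finite_part_retract G' T (enum_fset s) finT.
  move=> p Tp; split.
  - by move=> z zp; apply: inS; right; exists p => //; left.
  - by apply: inS; right; exists p => //; right; left.
  - by apply: inS; right; exists p => //; right; right.
pose sigma v : set free_web := (phi @` [set z | A z /\ rho v z])%classic.
have /(le_subset _ _).1 :
    (interp (graph_model free_web) M sigma <= interp (graph_model free_web) N sigma)%O.
  exact: MN.
move=> /(_ (phi x)) MNx.
apply: (interp_pull psiE (sigma := sigma)).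
- move=> v _ w [z [Az rz] <-]; rewrite psiK => [[<-]//|].
  by apply: inS; left; right.
- apply: MNx; apply: AT => // v z Az rz; by exists z.
- by apply: psiK; apply: inS; left; left.
Qed.

End Minimality.

Lemma theory_of_order_theory (M : lambda_model) t u :
  theory M (t, u) <-> order_theory M (t, u) /\ order_theory M (u, t).
Proof.
split=> [H|[tu ut] rho]; last by apply/eqP; rewrite eq_le tu ut.
by split=> rho /=; rewrite H.
Qed.

Theorem theorem3 :
  exists G : total_pair,
    effective (graph_model G) /\
    forall G' : total_pair,
      order_theory (graph_model G) `<=` order_theory (graph_model G') /\
      theory (graph_model G) `<=` theory (graph_model G').
Proof.
exists free_web; split; first exact: effective_free.
move=> G'; have le := @order_theory_minimum G'; split=> // -[t u].
by move=> /theory_of_order_theory[/le tu /le ut]; apply/theory_of_order_theory.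
Qed.
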